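(* (1) All Hadamard matrices of a fixed size are mutually quantum isomorphic: if $H$ and $H'$ are Hadamard matrices of the same size $N$, then $H$ and $H'$ are quantum isomorphic. (2) All Hadamard graphs of a fixed size are mutually quantum isomorphic: if $\mathfrak{H}$ and $\mathfrak{H}'$ are Hadamard graphs corresponding to Hadamard matrices of the same size, then $\mathfrak{H}$ and $\mathfrak{H}'$ are quantum isomorphic.
   Context: Hadamard matrix of size $N$: an $N\times N$ matrix $H$ with entries $\pm1$ and $HH^{T}=N\cdot I=H^{T}H$. A matrix $q=(q^i_j)$ (possibly rectangular) with entries in a unital $*$-algebra is cubic if it is orthogonal ($q^i_j=(q^i_j)^*$, $qq^{T}=1$, $q^{T}q=1$) and $q^i_jq^i_k=0=q^j_iq^k_i$ for $j\neq k$. A matrix $u$ is a magic unitary if it is unitary, $(u^i_j)^2=u^i_j=(u^i_j)^*$, and all row sums and column sums equal $1$. Hadamard matrices $H$ (size $N$) and $H'$ (size $N'$) are quantum isomorphic if there exists a (nonzero, unital) $*$-algebra $\mathscr{A}$ generated by the entries of a cubic $N'\times N$ matrix $q$ over $\mathscr{A}$ such that $p=H'qH^{-1}$ is also cubic. Hadamard graph of $H$: with $J$ the all-ones matrix and $H^\pm=\frac12(J\pm H)$, it is the graph on $4N$ vertices with adjacency matrix $$A=\begin{pmatrix}0&0&H^+&H^-\\0&0&H^-&H^+\\H^{+T}&H^{-T}&0&0\\H^{-T}&H^{+T}&0&0\end{pmatrix}.$$ Graphs with adjacency matrices $A$, $A'$ are quantum isomorphic if there is a magic unitary $u$ with entries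 in some (nonzero, unital) $*$-algebra such that $uA=A'u$. *)

(* Defs.v *)
From HB Require Import structures.
From mathcomp Require Import all_boot all_order all_algebra.
From mathcomp Require Import complex.
From mathcomp Require Import reals.

Set Implicit Arguments.
Unset Strict Implicit.
Unset Printing Implicit Defensive.

Import Order.TTheory GRing.Theory Num.Theory.
Local Open Scope ring_scope.

(* Unital *-algebras over C: no norm, completeness or positivity is required. *)
(* An algType is an nzRingType (1 != 0), so a starAlgType is a nonzero        *)
(* algebra.                                                                   *)
HB.mixin Record isStarAlgebra (C : numClosedFieldType) A of GRing.Algebra C A
    := {
  star : A -> A;
  starK : involutive star;
  star_semilinear :
    forall (a : C) (x y : A), star (a *: x + y) = a^* *: star x + star y;
  starM : forall x y : A, star (x * y) = star y * star x
}.

#[short(type="starAlgType")]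
HB.structure Definition StarAlgebra (C : numClosedFieldType) :=
  {A of GRing.Algebra C A & isStarAlgebra C A}.

(* The unital *-subalgebra generated by X (0 and opposites are obtained with  *)
(* a = -1 in star_gen_lin).                                                   *)
Inductive star_gen (C : numClosedFieldType) (A : starAlgType C)
    (X : A -> Prop) : A -> Prop :=
| star_gen_in x of X x : star_gen X x
| star_gen_1 : star_gen X 1
| star_gen_lin (a : C) x y of star_gen X x & star_gen X y :
    star_gen X (a *: x + y)
| star_gen_mul x y of star_gen X x & star_gen X y : star_gen X (x * y)
| star_gen_star x of star_gen X x : star_gen X (star x).

Section MatricesOverStarAlgebras.
Variables (C : numClosedFieldType) (A : starAlgType C).

Definition generated_by_entries m n (q : 'M[A]_(m, n)) : Prop :=
  forall x : A, star_gen (fun y => exists i j, y = q i j) x.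

Definition orthogonal_mx m n (q : 'M[A]_(m, n)) : Prop :=
  [/\ forall i j, star (q i j) = q i j,
      q *m q^T = 1%:M
    & q^T *m q = 1%:M].

Definition cubic m n (q : 'M[A]_(m, n)) : Prop :=
  [/\ orthogonal_mx q,
      forall i j k, j != k -> q i j * q i k = 0
    & forall i j k, j != k -> q j i * q k i = 0].

Definition unitary_mx m n (u : 'M[A]_(m, n)) : Prop :=
  let ustar := (map_mx star u)^T in
  u *m ustar = 1%:M /\ ustar *m u = 1%:M.

Definition magic_unitary m n (u : 'M[A]_(m, n)) : Prop :=
  [/\ unitary_mx u,
      forall i j, u i j * u i j = u i j /\ star (u i j) = u i j,
      forall i, \sum_j u i j = 1
    & forall j, \sum_i u i j = 1].

(* Scalar matrices entries c : C are read in A as c *: 1. *)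
Definition scalars_mx m n (M : 'M[C]_(m, n)) : 'M[A]_(m, n) :=
  map_mx (in_alg A) M.

End MatricesOverStarAlgebras.

Section Hadamard.
Variable C : numClosedFieldType.

Definition hadamard_mx N (H : 'M[C]_N) : Prop :=
  [/\ forall i j, H i j = 1 \/ H i j = -1,
      H *m H^T = N%:R%:M
    & H^T *m H = N%:R%:M].

Definition hadamard_qiso N N' (H : 'M[C]_N) (H' : 'M[C]_N') : Prop :=
  exists (A : starAlgType C) (q : 'M[A]_(N', N)),
    [/\ generated_by_entries q,
        cubic q
      & cubic (scalars_mx A H' *m q *m scalars_mx A (invmx H))].

Record sgraph (n : nat) := SGraph {
  edge : rel 'I_n;
  edge_sym : symmetric edge;
  edge_irrefl : irreflexive edge
}.

Definition adjmx n (G : sgraph n) : 'M[C]_n :=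
  \matrix_(i, j) (edge G i j)%:R.

Definition graph_qiso n n' (G : sgraph n) (G' : sgraph n') : Prop :=
  exists (A : starAlgType C) (u : 'M[A]_(n', n)),
    magic_unitary u /\
    u *m scalars_mx A (adjmx G) = scalars_mx A (adjmx G') *m u.

Definition hplus N (H : 'M[C]_N) : 'M[C]_N := 2%:R^-1 *: (const_mx 1 + H).
Definition hminus N (H : 'M[C]_N) : 'M[C]_N := 2%:R^-1 *: (const_mx 1 - H).

Definition hadamard_adjmx N (H : 'M[C]_N) : 'M[C]_((N + N) + (N + N)) :=
  block_mx
    0 (block_mx (hplus H) (hminus H) (hminus H) (hplus H))
    (block_mx (hplus H)^T (hminus H)^T (hminus H)^T (hplus H)^T) 0.

Definition hadamard_graph_of N (H : 'M[C]_N)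
    (G : sgraph ((N + N) + (N + N))) : Prop :=
  adjmx G = hadamard_adjmx H.

(* The matrix above is symmetric with entries in {0, 1} and zero diagonal, so *)
(* every Hadamard matrix has a Hadamard graph.                                *)
Lemma hadamard_graph_exists N (H : 'M[C]_N) :
  hadamard_mx H -> exists G, hadamard_graph_of H G.
Proof.
case=> Hpm _ _.
have n2 : (2%:R : C) != 0 by rewrite pnatr_eq0.
have Pp i j : hplus H i j = 0 \/ hplus H i j = 1.
  rewrite !mxE; case: (Hpm i j) => ->.
    by right; rewrite -[1 + 1]/(2%:R) mulVf.
  by left; rewrite subrr mulr0.
have Pm i j : hminus H i j = 0 \/ hminus H i j = 1.
  rewrite !mxE; case: (Hpm i j) => ->.
    by left; rewrite subrr mulr0.
  by right; rewrite opprK -[1 + 1]/(2%:R) mulVf.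
pose M := hadamard_adjmx H.
have Msym : M^T = M.
  by rewrite /M /hadamard_adjmx !tr_block_mx !trmxK !trmx0.
have M01 x y : M x y = 0 \/ M x y = 1.
  rewrite /M /hadamard_adjmx.
  case: (split_ordP x) => i ->; case: (split_ordP y) => j ->;
  rewrite ?block_mxEul ?block_mxEur ?block_mxEdl ?block_mxEdr;
  try (by left; rewrite mxE);
  case: (split_ordP i) => k ->; case: (split_ordP j) => l ->;
  rewrite ?block_mxEul ?block_mxEur ?block_mxEdl ?block_mxEdr;
  by [exact: Pp | exact: Pm | rewrite mxE; exact: Pp | rewrite mxE; exact: Pm].
have Mirr x : M x x = 0.
  rewrite /M /hadamard_adjmx; case: (split_ordP x) => i ->;
  by rewrite ?block_mxEul ?block_mxEdr mxE.
have es : symmetric (fun x y => M x y != 0).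
  by move=> x y; rewrite -{1}Msym mxE.
have ei : irreflexive (fun x y => M x y != 0).
  by move=> x; rewrite Mirr eqxx.
exists (SGraph es ei); apply/matrixP => x y; rewrite mxE /= -/M.
by case: (M01 x y) => ->; rewrite ?eqxx ?oner_eq0.
Qed.

End Hadamard.

(* Main.v *)
Require Import Defs.
From HB Require Import structures.
From mathcomp Require Import all_boot all_order all_algebra.
From mathcomp Require Import complex.
From mathcomp Require Import reals.
From mathcomp Require Import boolp functions.

Set Implicit Arguments.
Unset Strict Implicit.
Unset Printing Implicit Defensive.

Import Order.TTheory GRing.Theory Num.Theory.
Local Open Scope ring_scope.

(** Part (1) asks for a nonzero *-algebra.  In the universal algebra on the
entries of q, the unit is nonzero as soon as some linear functional on words
in the letters q_ij sends the empty word to 1 and kills every relation in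
every context.  Such a functional is found by reading the relations as planar
diagrams.

Think of the strand C^N as a region (carrying an index of H, called white
here) bounded by a red and a blue line, so that a word q_1 ... q_k is the word
of lines rb|br|rb|...  In any such word of lines every second region carries
an index, of a column of H (a white label) or of a row (a black one) according
to the parity of the number of red lines on its left; the remaining regions
carry nothing.  A red line crosses a blue line at the cost of an entry of H
between the adjacent white and black labels.  Because the entries of H are
signs and its rows and columns are orthogonal, pairs of parallel lines of one
colour slide freely across lines of the other colour (tlproj_slide,
pair_slide, cup_slide).  Hence pulling all the red lines to the left gives an
operator sort_strands which turns the projections that encode cubicity of q
(white_proj) and of p = H' q H^-1 (black_proj) into Temperley-Lieb projections
on two red or on two blue lines.  These involve no crossing, so they do not
depend on H (sort_white, sort_black, sort_cups).

Writing U, U' for the sorting operators of H and H', the functional is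
therefore phi(q_{i_1 j_1} ... q_{i_k j_k}) = c_k <U' e_i, U e_j>: a relation
on the side of H is carried by a symmetric operator to the same relation on
the side of H'.  The constants c_k make the contraction relations
sum_m q_im q_im = 1 hold; the contraction moves freely along a word by
cubicity, and at the head of the word it is a computation with cups
(functional_white, functional_black, functional_row, functional_col).

The functionals that kill the relations form a module on which the letters act
by shifts.  Acting by an operator together with its formal adjoint gives a
*-algebra without any quotient (star_algebra_of_functional).

For part (2), an entry x of a cubic matrix Q splits as the difference of the
idempotents (x^2 + x)/2 and (x^2 - x)/2, which form a magic unitary of twice
the size (signed_mx_magic); the diagonal sum of those of p and q intertwines
the two Hadamard graphs because p H = H' q and q H^T = H'^T p
(signed_mx_intertwine). *)

(** * Line diagrams as operators on labellings *)

(** The labels of the successive labelled regions are kept in an infinite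
sequence, so that local operators need no bounds; only finitely many labels
ever matter. *)
Definition scons (I : Type) (x : I) (s : nat -> I) : nat -> I :=
  fun n => if n is m.+1 then s m else x.
Definition stail (I : Type) (s : nat -> I) : nat -> I := fun n => s n.+1.

Lemma scons_stail (I : Type) (s : nat -> I) : scons (s 0%N) (stail s) = s.
Proof. by apply/funext; case. Qed.

Section Strands.
Variables (C : fieldType) (I : finType).
Hypothesis cardI_neq0 : #|I|%:R != 0 :> C.

Notation state := ((nat -> I) -> C).
Notation nI := (#|I|%:R : C).

(** Adds one labelled region, that is two lines, to the left. *)
Definition lift (op : state -> state) (g : state) : state :=
  fun s => op (fun s' => g (scons (s 0%N) s')) (stail s).

Definition linear_op (op : state -> state) :=
  forall (J : finType) (a : J -> C) (g : J -> state),
    op (fun s => \sum_j a j * g j s) = fun s => \sum_j a j * op (g j) s.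

(** An operator located at the region that follows line n.  That region is
labelled for even n, and the operator mixes the values of its label through k;
for odd n it lies between two labelled regions, and the operator multiplies by
a weight w of their labels. *)
Fixpoint local_op (k w : I -> I -> C) (n : nat) : state -> state :=
  match n with
  | 0 => fun g s => \sum_c k c (s 0%N) * g (scons c (stail s))
  | 1 => fun g s => w (s 0%N) (s 1%N) * g s
  | m.+2 => lift (local_op k w m)
  end.

Lemma linear_lift op : linear_op op -> linear_op (lift op).
Proof. by move=> lop J a g; apply/funext => s; rewrite /lift lop. Qed.

Lemma linear_comp op1 op2 :
  linear_op op1 -> linear_op op2 -> linear_op (op1 \o op2).
Proof. by move=> l1 l2 J a g; rewrite /= l2 l1. Qed.

Lemma linear_scale op : linear_op op ->
  forall a g, op (fun s => a * g s) = fun s => a * op g s.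
Proof.
move=> lop a g; have := lop unit (fun=> a) (fun=> g).
by rewrite (_ : (fun s => \sum_(j : unit) a * g s) = (fun s => a * g s));
  [move=> -> |]; apply/funext => s; rewrite big_const card_unit /= addr0.
Qed.

Lemma linear_local k w n : linear_op (local_op k w n).
Proof.
elim/ltn_ind: n => -[_ J a g|[_ J a g|n IH]] /=; last first.
- exact/linear_lift/IH.
- by apply/funext => s; rewrite mulr_sumr; apply: eq_bigr => j _; rewrite mulrCA.
apply/funext => s; under eq_bigr do rewrite mulr_sumr.
rewrite exchange_big; apply: eq_bigr => j _ /=.
by rewrite mulr_sumr; apply: eq_bigr => c _; rewrite mulrCA.
Qed.

Lemma lift_lift op1 op2 g : lift op1 (lift op2 g) = lift (op1 \o op2) g.
Proof. by []. Qed.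

Lemma lift_local0 k w op g : linear_op op ->
  lift op (local_op k w 0 g) = local_op k w 0 (lift op g).
Proof. by move=> lop; apply/funext => s; rewrite /lift /= lop. Qed.

Lemma lift2_local1 k w op g : linear_op op ->
  lift (lift op) (local_op k w 1 g) = local_op k w 1 (lift (lift op) g).
Proof. by move=> lop; apply/funext => s; rewrite /lift /= linear_scale. Qed.

Lemma lift2_local k w op n g : linear_op op -> (n <= 2)%N ->
  lift (lift op) (local_op k w n g) = local_op k w n (lift (lift op) g).
Proof.
move=> lop; case: n => [_|[_|[_|//]]].
- exact/lift_local0/linear_lift.
- exact: lift2_local1.
rewrite [local_op k w 2]/= !lift_lift; congr lift; apply/funext => h /=.
exact: lift_local0.
Qed.

(** Operators at regions that are not adjacent commute.  The case of regions 1
and 3, which share a label, works since both operators are multiplications. *)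
Lemma local_comm k w k' w' n m g : (n.+2 <= m)%N ->
  local_op k' w' m (local_op k w n g) = local_op k w n (local_op k' w' m g).
Proof.
elim/ltn_ind: n m g => -[_|[_|n IH]] [|[|m]] g //= lnm.
- by rewrite (lift_local0 k w) //; exact: linear_local.
- case: m lnm => [|[|m]] // _; last first.
    by rewrite (lift2_local1 k w) //; exact: linear_local.
  by apply/funext => s; rewrite /lift /= !scons_stail mulrCA.
rewrite !lift_lift; congr lift; apply/funext => h /=.
by apply: IH => //.
Qed.

(** The Hadamard condition, with the first argument read as a white label. *)
Definition orthogonal_pm (G : I -> I -> C) :=
  [/\ forall a b, G a b * G a b = 1,
      forall a b, \sum_c G a c * G b c = nI *+ (a == b)
    & forall a b, \sum_c G c a * G c b = nI *+ (a == b)].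

Definition flip (G : I -> I -> C) a b := G b a.

Lemma orthogonal_pm_flip G : orthogonal_pm G -> orthogonal_pm (flip G).
Proof. by case=> h1 h2 h3; split=> // a b; rewrite /flip h1. Qed.

(** The crossing of a line moving right with the line after it: a labelled
region that gets squeezed changes its colour through G, and an unlabelled one
contributes the entry of G at its two neighbours. *)
Definition crossing G := local_op G (flip G).
(** The Temperley-Lieb projection on the two lines around a region: averaging
over a label, or identifying two labels. *)
Definition tlproj := local_op (fun _ _ => nI^-1) (fun a b => (a == b)%:R).

Lemma linear_crossing G n : linear_op (crossing G n).
Proof. exact: linear_local. Qed.
Lemma linear_tlproj n : linear_op (tlproj n).
Proof. exact: linear_local. Qed.

Lemma crossingS G n : crossing G n.+2 = lift (crossing G n). Proof. by []. Qed.
Lemma tlprojS n : tlproj n.+2 = lift (tlproj n). Proof. by []. Qed.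

Lemma sum_delta (b : I) (F : I -> C) : \sum_c (c == b)%:R * F c = F b.
Proof.
rewrite (bigD1 b) //= eqxx mul1r big1 ?addr0 // => c /negPf ->.
by rewrite mul0r.
Qed.

Lemma sum_orthogonal (K : I -> I -> C) (b : I) (F : I -> C) :
  (forall a b, \sum_c K a c * K b c = nI *+ (a == b)) ->
  \sum_t K b t * (\sum_c K c t * F c) = nI * F b.
Proof.
move=> hK; under eq_bigr do rewrite mulr_sumr.
rewrite exchange_big /= -(sum_delta b) mulr_sumr; apply: eq_bigr => c _.
under eq_bigr do rewrite mulrA.
by rewrite -mulr_suml hK eq_sym; case: eqP => _; rewrite ?mulr0n ?mul0r ?mulr0 ?mul1r.
Qed.

Lemma crossing_flip0 G g : orthogonal_pm G ->
  crossing (flip G) 0 (crossing G 0 g) = fun s => nI * g s.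
Proof.
case=> _ hr _; apply/funext => s; rewrite /crossing /= /flip.
under eq_bigr do rewrite /stail /=.
rewrite (sum_orthogonal (s 0%N) (fun c => g (scons c (stail s)))) //.
by rewrite scons_stail.
Qed.

Lemma orthogonal_sum (K : I -> I -> C) a b (x : C) :
  (forall a b, \sum_c K a c * K b c = nI *+ (a == b)) ->
  \sum_c K a c * (K b c * x) = nI * (a == b)%:R * x.
Proof.
move=> hK; under eq_bigr do rewrite mulrA.
by rewrite -mulr_suml hK; case: eqP => _; rewrite ?mulr0n ?mulr0 ?mulr1.
Qed.

Lemma orthogonal_average (K : I -> I -> C) b (F : I -> C) :
  (forall a b, \sum_c K a c * K b c = nI *+ (a == b)) ->
  \sum_t nI^-1 * (K b t * (\sum_c K c t * F c)) = F b.
Proof. by move=> hK; rewrite -mulr_sumr sum_orthogonal // mulKf. Qed.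

Lemma sum_deltaM (b : I) (K F : I -> C) :
  \sum_c K c * ((c == b)%:R * F c) = K b * F b.
Proof. by under eq_bigr do rewrite mulrCA; rewrite sum_delta. Qed.

(** A line passes across two lines of the other colour: a Reidemeister move,
which for odd n uses column orthogonality and for even n row orthogonality. *)
Lemma tlproj_slide G n g : orthogonal_pm G ->
  tlproj n (crossing G n.+1 (crossing G n g)) =
  crossing G n.+1 (crossing G n (tlproj n.+1 g)).
Proof.
case=> G1 hr hc; elim/ltn_ind: n g => -[_|[_|n IH]] g; last first.
- rewrite !tlprojS !crossingS !lift_lift; congr lift; apply/funext => h /=.
  exact: IH.
- apply/funext => s; rewrite /tlproj /crossing /= /lift /= /stail /flip /=.
  rewrite (orthogonal_sum (K := flip G)) // -mulr_sumr [nI * _]mulrC -mulrA.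
  rewrite mulVKf // eq_sym !mulr_sumr; apply: eq_bigr => i _.
  by case: eqP => [->|_]; rewrite ?mul0r // !mul1r mulrA G1 mul1r.
- apply/funext => s; rewrite /tlproj /crossing /= /stail /flip /=.
  rewrite (orthogonal_average _ (fun c => g (scons c (fun n => s n.+1)))) //.
  by rewrite sum_deltaM mulrA G1 mul1r.
Qed.

(** Two lines pass across one line of the other colour.  The first one meets
labels of the opposite colour, hence the flip. *)
Lemma pair_slide G n g : orthogonal_pm G ->
  crossing (flip G) n (crossing G n.+1 (tlproj n g)) =
  tlproj n.+1 (crossing (flip G) n (crossing G n.+1 g)).
Proof.
case=> G1 hr hc; elim/ltn_ind: n g => -[_|[_|n IH]] g; last first.
- rewrite !tlprojS !crossingS !lift_lift; congr lift; apply/funext => h /=.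
  exact: IH.
- apply/funext => s; rewrite /tlproj /crossing /= /lift /= /stail /flip /=.
  rewrite (orthogonal_average _
             (fun c => g (scons (s 0%N) (scons c (fun n => s n.+2))))) //.
  under eq_bigr do rewrite eq_sym.
  by rewrite sum_deltaM mulrA G1 mul1r.
- apply/funext => s; rewrite /tlproj /crossing /= /stail /flip /=.
  rewrite (orthogonal_sum (K := G)) // -mulr_sumr [nI * _]mulrC -mulrA.
  rewrite mulVKf // !mulr_sumr; apply: eq_bigr => i _.
  by case: eqP => [->|_]; rewrite ?mul0r // !mul1r mulrA G1 mul1r.
Qed.

(** Creation of two adjacent lines: a new free label, or a duplicated one. *)
Fixpoint cup (n : nat) : state -> state :=
  match n with
  | 0 => fun g s => g (stail s)
  | 1 => fun g s => (s 0%N == s 1%N)%:R * g (stail s)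
  | m.+2 => lift (cup m)
  end.

(** Value of the closed loop around a labelled or unlabelled region. *)
Definition loop n : C := if odd n then 1 else nI.

Lemma cup_slide G n g : orthogonal_pm G ->
  crossing (flip G) n (crossing G n.+1 (cup n g)) = fun s => loop n * cup n.+1 g s.
Proof.
case=> G1 hr hc; elim/ltn_ind: n g => -[_|[_|n IH]] g; last first.
- rewrite !crossingS /= !lift_lift; apply/funext => s; rewrite {1}/lift /= IH //.
  by rewrite /loop /= negbK.
- apply/funext => s; rewrite /crossing /= /lift /= /stail /flip /= mul1r.
  under eq_bigr do rewrite eq_sym.
  by rewrite sum_deltaM mulrA G1 mul1r.
- apply/funext => s; rewrite /crossing /= /stail /flip /= /loop /=.
  by rewrite (orthogonal_sum (K := G)) // mulrA.
Qed.

(** A line moves right across n lines, starting at position a. *)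
Fixpoint pass G a n g :=
  if n is n'.+1 then pass G a.+1 n' (crossing G a g) else g.

Lemma linear_pass G a n : linear_op (pass G a n).
Proof.
elim: n a => [//|n IH] a /=.
exact: (linear_comp (IH _) (linear_crossing G a)).
Qed.

Lemma pass_local_far k w G a n m g : (m.+2 <= a)%N || (a + n < m)%N ->
  pass G a n (local_op k w m g) = local_op k w m (pass G a n g).
Proof.
elim: n a g => [//|n IH] a g /orP h /=.
rewrite (_ : crossing G a (local_op k w m g) = local_op k w m (crossing G a g)).
  by rewrite IH // !addSnnS; case: h => [/leqW ->|->]; rewrite ?orbT.
case: h => h; first exact: local_comm.
by rewrite local_comm //; apply: leq_trans h; rewrite addnS !ltnS leq_addr.
Qed.

(** A projection on two of the crossed lines moves by one position, since the
passing line ends up on their other side. *)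
Lemma pass_slide G a n j g : orthogonal_pm G -> (a <= j)%N -> (j.+1 < a + n)%N ->
  pass G a n (tlproj j.+1 g) = tlproj j (pass G a n g).
Proof.
move=> hG; elim: n a g => [|n IH] a g laj ljn.
  by move: ljn; rewrite addn0 ltnNge (leqW laj).
have [aj|neq] := eqVneq a j.
  rewrite -{}aj in ljn *; case: n IH ljn => [|n] IH; first by rewrite addn1 ltnn.
  move=> _.
  by rewrite /= -tlproj_slide // pass_local_far // leqnn.
have laj' : (a < j)%N by rewrite ltn_neqAle neq.
by rewrite /= -IH ?addSnnS //; congr (pass _ _ _ _); apply/esym/local_comm.
Qed.

Lemma pass_pass_crossing G a n g : 
  pass (flip G) a n.+1 (pass G a.+1 n.+1 g) =
  pass (flip G) a.+1 n (pass G a.+2 n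
     (crossing (flip G) a (crossing G a.+1 g))).
Proof. by rewrite /= -[crossing (flip G) a (pass _ _ _ _)]pass_local_far // leqnn. Qed.

(** A projection on a pair of passing lines travels with the pair. *)
Lemma pass2_slide G a n g : orthogonal_pm G ->
  pass (flip G) a n (pass G a.+1 n (tlproj a g)) =
  tlproj (a + n) (pass (flip G) a n (pass G a.+1 n g)).
Proof.
move=> hG; elim: n a g => [|n IH] a g; first by rewrite addn0.
by rewrite !pass_pass_crossing pair_slide // IH addSnnS.
Qed.

Definition loops a n : C := \prod_(a <= i < a + n) loop i.

Lemma pass2_cup G a n g : orthogonal_pm G ->
  pass (flip G) a n (pass G a.+1 n (cup a g)) =
  fun s => loops a n * cup (a + n) g s.
Proof.
move=> hG; elim: n a g => [|n IH] a g.
  by rewrite /loops addn0 big_geq //=; apply/funext => s; rewrite mul1r.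
rewrite !pass_pass_crossing cup_slide // !linear_scale; try exact: linear_pass.
rewrite IH -addSnnS; apply/funext => s.
by rewrite /loops [in RHS]big_ltn addnS ?mulrA ?ltnS ?leq_addr.
Qed.

Definition scale (a : C) (g : state) : state := fun s => a * g s.

Lemma linear_scaleE op a g : linear_op op -> op (scale a g) = scale a (op g).
Proof. by move/linear_scale->. Qed.

Lemma crossing_scale G n a g :
  crossing G n (scale a g) = scale a (crossing G n g).
Proof. exact/linear_scaleE/linear_crossing. Qed.

Lemma tlproj_scale n a g : tlproj n (scale a g) = scale a (tlproj n g).
Proof. exact/linear_scaleE/linear_tlproj. Qed.

Lemma pass_scale G a n b g : pass G a n (scale b g) = scale b (pass G a n g).
Proof. exact/linear_scaleE/linear_pass. Qed.

Lemma scale_scale a b g : scale a (scale b g) = scale (a * b) g.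
Proof. by apply/funext => s; rewrite /scale mulrA. Qed.

Lemma scale1 g : scale 1 g = g.
Proof. by apply/funext => s; rewrite /scale mul1r. Qed.

(** At a labelled region, crossing back undoes a crossing up to a factor: row
orthogonality. *)
Lemma crossing_flipK G n g : orthogonal_pm G -> ~~ odd n ->
  crossing (flip G) n (crossing G n g) = scale nI g.
Proof.
move=> hG; elim/ltn_ind: n g => -[_|[_|n IH]] g //.
  by move=> _; exact: crossing_flip0.
move=> /= hn; rewrite !crossingS lift_lift; apply/funext => s.
rewrite /lift /= IH //; last by rewrite negbK in hn.
by rewrite /scale scons_stail.
Qed.

Lemma lift_pass G a n op g :
  lift (fun h => pass G a n (op h)) g = pass G a.+2 n (lift op g).
Proof.
elim: n a op => [//|n IH] a op /=.
by rewrite (IH _ (fun h => crossing G a (op h))).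
Qed.

(** * Sorting the lines by colour *)

Section Sorting.
Variable H : I -> I -> C.
Hypothesis H_pm : orthogonal_pm H.

Let Ht_pm : orthogonal_pm (flip H) := orthogonal_pm_flip H_pm.

(** Brings a word of k strands to the form r^k b^k.  The first strand is rb when
b holds and br otherwise, and the orientation alternates.  Once the other
strands are sorted, the blue line of the first one moves right across all red
lines that follow it: k' of them for rb, k of them for br.  It changes black
labels to white in the first case and white to black in the second. *)
Fixpoint sort_strands (b : bool) k (g : state) : state :=
  if k is k'.+1 then
    if b then pass (flip H) 1 k' (lift (sort_strands (~~ b) k') g)
    else pass H 0 k (lift (sort_strands (~~ b) k') g)
  else g.

(** Projection on equal labels of the strands p and p+1. *)
Definition white_proj p g := tlproj p.*2.+1 g.

(** The same projection in the basis of the columns of H, i.e. conjugated by H on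
both strands. *)
Definition black_proj p g :=
  scale (nI ^- 2) (crossing (flip H) p.*2 (crossing (flip H) p.*2.+2
    (tlproj p.*2.+1 (crossing H p.*2.+2 (crossing H p.*2 g))))).

Lemma linear_sort b k : linear_op (sort_strands b k).
Proof.
elim: k b => [//|k IH] [].
  exact: (linear_comp (linear_pass (flip H) 1 k) (linear_lift (IH false))).
exact: (linear_comp (linear_pass H 0 k.+1) (linear_lift (IH true))).
Qed.

Lemma sort_scale b k a g :
  sort_strands b k (scale a g) = scale a (sort_strands b k g).
Proof. exact/linear_scaleE/linear_sort. Qed.

Lemma sort_trueSS k g : sort_strands true k.+2 g =
  pass (flip H) 1 k.+1 (pass H 2 k.+1 (lift (lift (sort_strands true k)) g)).
Proof. by rewrite -(lift_pass H 0 k.+1). Qed.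

Lemma sort_falseSS k g : sort_strands false k.+2 g =
  pass H 0 k.+2 (pass (flip H) 3 k (lift (lift (sort_strands false k)) g)).
Proof. by rewrite -(lift_pass (flip H) 1 k). Qed.

Lemma lift2_crossing op G n g : linear_op op -> (n <= 2)%N ->
  lift (lift op) (crossing G n g) = crossing G n (lift (lift op) g).
Proof. exact: lift2_local. Qed.

Lemma lift2_tlproj op n g : linear_op op -> (n <= 2)%N ->
  lift (lift op) (tlproj n g) = tlproj n (lift (lift op) g).
Proof. exact: lift2_local. Qed.

Lemma lift2_black_proj op g : linear_op op ->
  lift (lift op) (black_proj 0 g) = black_proj 0 (lift (lift op) g).
Proof.
move=> lop; rewrite linear_scaleE; last exact/linear_lift/linear_lift.
by rewrite !lift2_crossing // lift2_tlproj // !lift2_crossing.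
Qed.

Lemma crossing_comm G G' g :
  crossing G' 2 (crossing G 0 g) = crossing G 0 (crossing G' 2 g).
Proof. exact: local_comm. Qed.

Lemma pass_tlproj_far G a n m g : (m.+2 <= a)%N || (a + n < m)%N ->
  pass G a n (tlproj m g) = tlproj m (pass G a n g).
Proof. exact: pass_local_far. Qed.

Lemma pass_crossing_far G G' a n m g : (m.+2 <= a)%N || (a + n < m)%N ->
  pass G a n (crossing G' m g) = crossing G' m (pass G a n g).
Proof. exact: pass_local_far. Qed.

Lemma nI_cancel2 : nI ^- 2 * nI * nI = 1.
Proof. by rewrite -mulrA -expr2 mulVf ?expf_neq0. Qed.

(** The two adjacent inner lines of rb|br are blue: they travel together across
all the k+1 red lines. *)
Lemma sort_white_true k g :
  sort_strands true k.+2 (white_proj 0 g) =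
  tlproj k.+2 (sort_strands true k.+2 g).
Proof.
rewrite !sort_trueSS /white_proj lift2_tlproj //; last exact: linear_sort.
by rewrite pass2_slide // add1n.
Qed.

(** The inner lines of br|rb are red: they are crossed by a single blue line. *)
Lemma sort_white_false k g :
  sort_strands false k.+2 (white_proj 0 g) =
  tlproj 0 (sort_strands false k.+2 g).
Proof.
rewrite !sort_falseSS /white_proj lift2_tlproj //; last exact: linear_sort.
by rewrite pass_tlproj_far // pass_slide.
Qed.

(** In rb|br, crossing both blue lines out makes the red ones adjacent; the
projection is then at the far left and meets no further crossing. *)
Lemma sort_black_true k g :
  sort_strands true k.+2 (black_proj 0 g) =
  tlproj 0 (sort_strands true k.+2 g).
Proof.
rewrite !sort_trueSS lift2_black_proj; last exact: linear_sort.
rewrite !pass_pass_crossing; set h := lift _ _.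
have -> : crossing (flip H) 1 (crossing H 2 (black_proj 0 h)) =
          tlproj 0 (crossing (flip H) 1 (crossing H 2 h)).
  rewrite /black_proj !crossing_scale.
  rewrite crossing_comm (crossing_flipK (G := flip H)) //.
  rewrite !crossing_scale.
  rewrite -tlproj_slide // -[crossing (flip H) 0 (crossing H 2 _)]crossing_comm.
  by rewrite crossing_flipK // !(crossing_scale, tlproj_scale) !scale_scale nI_cancel2 scale1.
by rewrite pass_tlproj_far // pass_tlproj_far.
Qed.

(** In br|rb, crossing both red lines out makes the blue ones adjacent, and they
then travel together across the remaining red lines. *)
Lemma sort_black_false k g :
  sort_strands false k.+2 (black_proj 0 g) =
  tlproj k.+2 (sort_strands false k.+2 g).
Proof.
rewrite !sort_falseSS lift2_black_proj; last exact: linear_sort.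
set h := lift _ _; rewrite [pass H 0 _ _]/= [pass H 0 _ (pass _ _ _ h)]/=.
rewrite -!(pass_crossing_far (flip H) H (a := 3) (m := 0)) //.
have -> : crossing H 0 (black_proj 0 h) = scale nI^-1 (crossing (flip H) 2
    (tlproj 1 (crossing H 2 (crossing H 0 h)))).
  rewrite /black_proj crossing_scale.
  rewrite (crossing_flipK (G := flip H)) // scale_scale; congr scale.
  by rewrite expr2 invfM -mulrA mulVf // mulr1.
set h' := crossing H 0 h.
(* The first crossing of each pass is split off, resp. put back. *)
have E x : pass H 2 k (crossing H 1 (pass (flip H) 3 k (crossing (flip H) 2 x)))
    = pass (flip (flip H)) 1 k.+1 (pass (flip H) 2 k.+1 x) by [].
rewrite !(pass_scale, crossing_scale).
rewrite E pass2_slide // -E crossing_flipK //.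
by rewrite !(pass_scale, crossing_scale, tlproj_scale) scale_scale mulVf // scale1.
Qed.

(** One more strand on the left: its blue line slides across a projection on red
lines, and stops before a projection on blue lines.  The index p stands for the
red lines p, p+1 and the index k+p for the blue ones. *)
Lemma sort_lift b k op (q : bool) p g : (p.+2 <= k)%N ->
  (forall h, sort_strands (~~ b) k (op h) =
             tlproj (if q then (k + p)%N else p) (sort_strands (~~ b) k h)) ->
  sort_strands b k.+1 (lift op g) =
  tlproj (if q then (k.+1 + p.+1)%N else p.+1) (sort_strands b k.+1 g).
Proof.
move=> lpk hop /=.
have -> : lift (sort_strands (~~ b) k) (lift op g) =
    tlproj (if q then k + p else p).+2 (lift (sort_strands (~~ b) k) g).
  by rewrite tlprojS !lift_lift; congr lift; apply/funext => h /=.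
rewrite -![pass H 1 k _]/(pass H 0 k.+1 _).
case: q {hop}; last by case: b; rewrite pass_slide.
rewrite addSn addnS.
by case: b; rewrite pass_tlproj_far //= ?add1n ?add0n !ltnS ?leq_addr // leqW // leq_addr.
Qed.

Lemma sort_white b k p g : (p.+2 <= k)%N ->
  sort_strands b k (white_proj p g) =
  tlproj (if b (+) odd p then (k + p)%N else p) (sort_strands b k g).
Proof.
elim: p b k g => [|p IH] b [|k] g // lpk.
  case: k lpk => [|k] // _; rewrite addbF addn0.
  by case: b; rewrite ?sort_white_true ?sort_white_false.
rewrite /= addbN -addNb; apply: (sort_lift (op := white_proj p)) => // h.
exact: IH.
Qed.

Lemma sort_black b k p g : (p.+2 <= k)%N ->
  sort_strands b k (black_proj p g) =
  tlproj (if b (+) odd p then p else (k + p)%N) (sort_strands b k g).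
Proof.
rewrite -if_neg -addNb.
elim: p b k g => [|p IH] b [|k] g // lpk.
  case: k lpk => [|k] // _; rewrite addbF addn0.
  by case: b; rewrite ?sort_black_true ?sort_black_false.
rewrite /= addbN -addNb; apply: (sort_lift (op := black_proj p)) => // h.
exact: IH.
Qed.

Lemma lift2_cups op g : linear_op op ->
  lift (lift op) (cup 1 (cup 0 g)) = cup 1 (cup 0 (op g)).
Proof. by move=> lop; apply/funext => s; rewrite /lift /= linear_scale. Qed.

(** Two new strands at the head of the word become a pair of blue lines after
the red ones, and a pair of red lines at the head; no entry of H remains. *)
Lemma sort_cups k g : sort_strands true k.+2 (cup 1 (cup 0 g)) =
  scale (loops 1 k.+1) (cup k.+2 (cup 0 (sort_strands true k g))).
Proof.
rewrite sort_trueSS lift2_cups; last exact: linear_sort.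
by rewrite pass2_cup.
Qed.

End Sorting.

(** * The pairing of labellings *)

Variable z : I.

(** Sum over the first k labels; the other ones are set to z, an arbitrary value,
as the summand is meant to ignore them. *)
Fixpoint sum_labels k (g : state) : C :=
  if k is k'.+1 then \sum_x sum_labels k' (fun s => g (scons x s))
  else g (fun=> z).

Definition pairing k g' g := sum_labels k (fun s => g' s * g s).

Lemma eq_sum_labels k g g' : g =1 g' -> sum_labels k g = sum_labels k g'.
Proof. by move/funext->. Qed.

Lemma pairingS k g' g : pairing k.+1 g' g =
  \sum_x pairing k (fun s => g' (scons x s)) (fun s => g (scons x s)).
Proof. by []. Qed.

Lemma linear_sum_labels k (J : finType) (a : J -> C) (g : J -> state) :
  sum_labels k (fun s => \sum_j a j * g j s) = \sum_j a j * sum_labels k (g j).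
Proof.
elim: k g => [//|k IH] g /=.
under eq_bigr do rewrite (IH (fun j s => g j (scons _ s))).
by rewrite exchange_big; apply: eq_bigr => j _; rewrite mulr_sumr.
Qed.

Lemma pairingC k g' g : pairing k g' g = pairing k g g'.
Proof. by apply: eq_sum_labels => s; rewrite mulrC. Qed.

Lemma pairing_suml k (J : finType) (a : J -> C) (g' : J -> state) g :
  pairing k (fun s => \sum_j a j * g' j s) g = \sum_j a j * pairing k (g' j) g.
Proof.
rewrite /pairing -linear_sum_labels; apply: eq_sum_labels => s.
by rewrite mulr_suml; apply: eq_bigr => j _; rewrite mulrA.
Qed.

Lemma pairing_sumr k (J : finType) (a : J -> C) g' (g : J -> state) :
  pairing k g' (fun s => \sum_j a j * g j s) = \sum_j a j * pairing k g' (g j).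
Proof.
by rewrite pairingC pairing_suml; under eq_bigr do rewrite pairingC.
Qed.

Lemma pairing_scalel k a g' g : pairing k (scale a g') g = a * pairing k g' g.
Proof.
have := pairing_suml k (fun _ : unit => a) (fun=> g') g.
rewrite big_const card_unit /= addr0 => <-; congr pairing.
by apply/funext => s; rewrite big_const card_unit /= addr0.
Qed.

Lemma pairing_scaler k a g' g : pairing k g' (scale a g) = a * pairing k g' g.
Proof. by rewrite pairingC pairing_scalel pairingC. Qed.

Lemma pairing_tlproj k n g' g : (n < k.*2)%N ->
  pairing k (tlproj n g') g = pairing k g' (tlproj n g).
Proof.
elim/ltn_ind: n k g' g => -[_|[_|n IH]] [|k] g' g //=.
- move=> _; rewrite !pairingS /tlproj /= /stail /=.
  under eq_bigr do rewrite pairing_suml.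
  under [RHS]eq_bigr do rewrite pairing_sumr.
  by rewrite exchange_big.
- move=> _; apply: eq_sum_labels => s; rewrite /tlproj /=.
  by rewrite mulrCA mulrA.
- rewrite !ltnS => lnk; rewrite !pairingS; apply: eq_bigr => x _.
  exact: (IH n (leqnSn n.+1) k (fun s => g' (scons x s)) (fun s => g (scons x s))).
Qed.

Lemma pairing_cup k n g' g : (n <= k.*2)%N ->
  pairing k.+1 (cup n g') (cup n g) = loop n * pairing k g' g.
Proof.
elim/ltn_ind: n k g' g => -[_|[_|n IH]] k g' g //=.
- move=> _; rewrite pairingS /= /stail /=.
  by rewrite sumr_const mulr_natl.
- case: k => [//|k] _; rewrite 2!pairingS mul1r; apply: eq_bigr => x _.
  rewrite pairingS (bigD1 x) //= [X in _ + X]big1 ?addr0.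
    by apply: eq_sum_labels => s; rewrite /= /stail eqxx !mul1r.
  move=> y /negPf xy; rewrite -[RHS](mul0r (pairing k g' g)) -pairing_scalel.
  by apply: eq_sum_labels => s; rewrite /= /scale eq_sym xy !mul0r.
- case: k => [//|k]; rewrite !ltnS => lnk.
  rewrite pairingS [in RHS]pairingS mulr_sumr; apply: eq_bigr => x _.
  by rewrite /loop /= negbK -IH.
Qed.

(** * Product states *)

Definition vcons (u : I -> C) (F : state) : state :=
  fun s => u (s 0%N) * F (stail s).
Definition ctx (us : seq (I -> C)) (F : state) : state := foldr vcons F us.
(** A basis vector of C^N. *)
Definition delta (i : I) : I -> C := fun c => (c == i)%:R.

Lemma ctx_cat us vs F : ctx (us ++ vs) F = ctx us (ctx vs F).
Proof. by rewrite /ctx foldr_cat. Qed.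

Lemma linear_vcons u : linear_op (vcons u).
Proof.
move=> J a g; apply/funext => s; rewrite /vcons mulr_sumr.
by apply: eq_bigr => j _; rewrite mulrCA.
Qed.

Lemma linear_ctx us : linear_op (ctx us).
Proof.
elim: us => [//|u us IH]; exact: (linear_comp (linear_vcons u) IH).
Qed.

Lemma vcons_scaler u a F : vcons u (scale a F) = scale a (vcons u F).
Proof. exact/linear_scaleE/linear_vcons. Qed.

Lemma ctx_scale us a F : ctx us (scale a F) = scale a (ctx us F).
Proof. exact/linear_scaleE/linear_ctx. Qed.

Lemma vcons_deltaE u F :
  vcons u F = fun s => \sum_i u i * vcons (delta i) F s.
Proof.
apply/funext => s; rewrite /vcons /delta.
by under eq_bigr do rewrite eq_sym; rewrite sum_deltaM.
Qed.

Lemma lift_vcons op u F : linear_op op -> lift op (vcons u F) = vcons u (op F).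
Proof.
by move=> lop; apply/funext => s; rewrite /lift /vcons /= linear_scale.
Qed.

(** An operator located at strand p acts on a product state behind a prefix of p
factors. *)
Lemma lift_family_ctx (X : nat -> state -> state) us F :
  (forall p, X p.+1 = lift (X p)) -> (forall p, linear_op (X p)) ->
  X (size us) (ctx us F) = ctx us (X 0%N F).
Proof.
by move=> XS lX; elim: us => [//|u us IH] /=; rewrite XS lift_vcons // IH.
Qed.

Lemma linear_white_proj p : linear_op (white_proj p).
Proof. exact: linear_tlproj. Qed.

Lemma linear_black_proj H p : linear_op (black_proj H p).
Proof.
move=> J a g; rewrite /black_proj.
do 2!rewrite (linear_crossing H); rewrite linear_tlproj.
do 2!rewrite (linear_crossing (flip H)).
apply/funext => s; rewrite /scale mulr_sumr.
by apply: eq_bigr => j _; rewrite mulrCA.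
Qed.

Lemma white_proj_ctx us F :
  white_proj (size us) (ctx us F) = ctx us (white_proj 0 F).
Proof. by apply: lift_family_ctx => // p; exact: linear_white_proj. Qed.

Lemma black_proj_ctx H us F :
  black_proj H (size us) (ctx us F) = ctx us (black_proj H 0 F).
Proof.
apply: (lift_family_ctx (X := black_proj H)) => p.
  by apply/funext => g; apply/funext => s; rewrite /black_proj /lift /scale.
exact: linear_black_proj.
Qed.

Lemma white_proj_delta i j F :
  white_proj 0 (vcons (delta i) (vcons (delta j) F)) =
  scale (i == j)%:R (vcons (delta i) (vcons (delta j) F)).
Proof.
apply/funext => s; rewrite /white_proj /tlproj /scale /= /vcons /delta /=.
rewrite /stail; have [->|] := eqVneq (s 0%N) i; last by rewrite !mul0r !mulr0.
by have [->|] := eqVneq (s 1%N) j; rewrite ?mul0r ?mulr0.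
Qed.

Lemma crossing0_vcons G u F :
  crossing G 0 (vcons u F) = vcons (fun b => \sum_c G c b * u c) F.
Proof.
apply/funext => s; rewrite /crossing /vcons /= mulr_suml.
by apply: eq_bigr => c _; rewrite mulrA.
Qed.

Lemma crossing2_vcons G u F :
  crossing G 2 (vcons u F) = vcons u (crossing G 0 F).
Proof. by rewrite crossingS lift_vcons //; exact: linear_crossing. Qed.

Lemma crossing02_vcons G u v F :
  crossing G 0 (crossing G 2 (vcons u (vcons v F))) =
  vcons (fun b => \sum_c G c b * u c) (vcons (fun b => \sum_c G c b * v c) F).
Proof. by rewrite crossing2_vcons !crossing0_vcons. Qed.

Lemma vcons_scale a u F : vcons (fun c => a * u c) F = scale a (vcons u F).
Proof. by apply/funext => s; rewrite /vcons /scale mulrA. Qed.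

(** Columns of H play for black_proj the role of basis vectors for white_proj,
since H maps them to multiples of basis vectors. *)
Lemma black_proj_column H a b F : orthogonal_pm H ->
  black_proj H 0 (vcons (H^~ a) (vcons (H^~ b) F)) =
  scale (a == b)%:R (vcons (H^~ a) (vcons (H^~ b) F)).
Proof.
move=> [_ _ hc].
rewrite /black_proj crossing_comm crossing02_vcons.
have E x : (fun y => \sum_c H c y * H c x) = (fun y => nI * delta x y).
  by apply/funext => y; rewrite hc /delta; case: eqP; rewrite ?mulr1 ?mulr0.
rewrite !E !vcons_scale !vcons_scaler scale_scale.
rewrite tlproj_scale -/(white_proj 0 _) white_proj_delta.
rewrite !crossing_scale crossing02_vcons !scale_scale.
have E' x : (fun y => \sum_c flip H c y * delta x c) = H^~ x.
  apply/funext => y; rewrite /delta /flip.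
  by under eq_bigr do rewrite mulrC; rewrite sum_delta.
by rewrite !E' mulrA nI_cancel2 mul1r.
Qed.

Lemma cupsE F :
  cup 1 (cup 0 F) = fun s => \sum_m vcons (delta m) (vcons (delta m) F) s.
Proof.
apply/funext => s; rewrite /vcons /delta /= /stail /=.
rewrite (eq_bigr (fun m => (m == s 0%N)%:R * ((s 1%N == m)%:R * F (fun n => s n.+2)))).
  by rewrite sum_delta eq_sym.
by move=> m _; rewrite eq_sym.
Qed.

(** The black projection of e_i e_i does not depend on i: in the basis of columns
the coefficients of e_i are signs, whose squares are 1. *)
Lemma black_proj_delta H i F : orthogonal_pm H ->
  black_proj H 0 (vcons (delta i) (vcons (delta i) F)) =
  scale nI^-1 (cup 1 (cup 0 F)).
Proof.
move=> [h1 hr hc].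
rewrite /black_proj crossing_comm crossing02_vcons.
have -> : (fun y => \sum_c H c y * delta i c) = H i.
  apply/funext => y; rewrite /delta.
  by under eq_bigr do rewrite mulrC; rewrite sum_delta.
have -> : tlproj 1 (vcons (H i) (vcons (H i) F)) = cup 1 (cup 0 F).
  apply/funext => s; rewrite /tlproj /vcons /= /stail /=.
  by have [->|] := eqVneq (s 0%N) (s 1%N); rewrite ?mul0r // !mul1r mulrA h1 mul1r.
rewrite (_ : cup 1 (cup 0 F) = fun s => \sum_m 1 * vcons (delta m) (vcons (delta m) F) s);
  last by rewrite cupsE; apply/funext => s; apply: eq_bigr => m _; rewrite mul1r.
do 2!rewrite (linear_crossing (flip H)).
under [X in scale _ X]funext => s do under eq_bigr => m _ do
  rewrite crossing02_vcons mul1r.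
apply/funext => s; rewrite /scale /vcons.
have E x y : \sum_c flip H c y * delta x c = H y x.
  rewrite /delta /flip.
  by under eq_bigr do rewrite mulrC; rewrite sum_delta.
under eq_bigr do rewrite !E.
rewrite orthogonal_sum // !mulrA expr2 invfM mulrVK ?unitfE //.
under [in RHS]eq_bigr => m _ do rewrite mul1r.
by have /(congr1 (@^~ s)) /= <- := cupsE F; rewrite mulrA.
Qed.

(** * The functional on words *)

Section Functional.
Variables H H' : I -> I -> C.
Hypotheses (H_pm : orthogonal_pm H) (H'_pm : orthogonal_pm H').

Definition psi k (g' g : state) : C :=
  pairing k (sort_strands H' true k g') (sort_strands H true k g).

Lemma psi_suml k L u F g : linear_op L ->
  psi k (L (vcons u F)) g = \sum_i u i * psi k (L (vcons (delta i) F)) g.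
Proof.
move=> lL; rewrite vcons_deltaE lL /psi linear_sort.
by rewrite pairing_suml.
Qed.

Lemma psi_sumr k L u F g : linear_op L ->
  psi k g (L (vcons u F)) = \sum_i u i * psi k g (L (vcons (delta i) F)).
Proof.
move=> lL; rewrite vcons_deltaE lL /psi linear_sort.
by rewrite pairing_sumr.
Qed.

Lemma psi_scalel k a g' g : psi k (scale a g') g = a * psi k g' g.
Proof. by rewrite /psi sort_scale pairing_scalel. Qed.

Lemma psi_scaler k a g' g : psi k g' (scale a g) = a * psi k g' g.
Proof. by rewrite /psi sort_scale pairing_scaler. Qed.

Lemma strand_index_lt k p (q : bool) : (p.+2 <= k)%N ->
  ((if q then k + p else p) < k.*2)%N.
Proof.
move=> pk; have pk' : (p < k)%N by exact: ltnW.
by case: q; rewrite -addnn ?ltn_add2l // ltn_addl.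
Qed.

Lemma psi_white k p g' g : (p.+2 <= k)%N ->
  psi k (white_proj p g') g = psi k g' (white_proj p g).
Proof.
by move=> pk; rewrite /psi !sort_white // pairing_tlproj // strand_index_lt.
Qed.

Lemma psi_black k p g' g : (p.+2 <= k)%N ->
  psi k (black_proj H' p g') g = psi k g' (black_proj H p g).
Proof.
move=> pk; rewrite /psi !sort_black // pairing_tlproj //.
by rewrite -if_neg strand_index_lt.
Qed.

(** Factor by which adding two strands at the head of both words changes the
pairing: two slides of the blue pair, then two loops. *)
Definition cup_norm k : C := loops 1 k.+1 ^+ 2 * loop k.+2 * nI.

Lemma psi_cups k g' g :
  psi k.+2 (cup 1 (cup 0 g')) (cup 1 (cup 0 g)) = cup_norm k * psi k g' g.
Proof.
rewrite /psi !sort_cups // pairing_scalel pairing_scaler.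
rewrite pairing_cup; last by rewrite doubleS !ltnS -addnn leq_addr.
by rewrite pairing_cup // /cup_norm expr2 !mulrA.
Qed.

Lemma cup_norm_neq0 k : cup_norm k != 0.
Proof.
have l0 n : loop n != 0 by rewrite /loop; case: ifP => _; rewrite ?oner_eq0.
have ls : loops 1 k.+1 != 0.
  by rewrite /loops prodf_seq_neq0; apply/allP => i _; rewrite l0.
by rewrite /cup_norm !mulf_neq0 ?expf_neq0.
Qed.

(** Chosen so that psi_norm k.+2 * cup_norm k = N * psi_norm k: summing the
contraction relation over its free index gives the factor N. *)
Fixpoint psi_norm k : C :=
  if k is k'.+2 then nI * (psi_norm k' / cup_norm k') else 1.

Definition word_state (xs : seq I) : state := ctx [seq delta i | i <- xs] (fun=> 1).

(** The value on q_{i_1 j_1} ... q_{i_k j_k}, the letters being pairs of indices;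
the first index belongs to H' and the second to H. *)
Definition functional (w : seq (I * I)) : C :=
  psi_norm (size w) *
  psi (size w) (word_state (unzip1 w)) (word_state (unzip2 w)).

Lemma functional_nil : functional [::] = 1.
Proof. by rewrite /functional /psi /pairing /= !mulr1. Qed.

Lemma word_state_cat xs ys :
  word_state (xs ++ ys) = ctx [seq delta i | i <- xs] (word_state ys).
Proof. by rewrite /word_state map_cat ctx_cat. Qed.

Lemma size_unzip1 (w : seq (I * I)) : size (unzip1 w) = size w.
Proof. exact: size_map. Qed.
Lemma size_unzip2 (w : seq (I * I)) : size (unzip2 w) = size w.
Proof. exact: size_map. Qed.

Lemma functional_cat2 a i i' j j' b (k := (size a + (size b).+2)%N) :
  functional (a ++ [:: (i, j); (i', j')] ++ b) =
  psi_norm k * psi k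
    (ctx [seq delta x | x <- unzip1 a]
       (vcons (delta i) (vcons (delta i') (word_state (unzip1 b)))))
    (ctx [seq delta x | x <- unzip2 a]
       (vcons (delta j) (vcons (delta j') (word_state (unzip2 b))))).
Proof.
rewrite /functional /unzip1 /unzip2 !map_cat -/unzip1 -/unzip2 !word_state_cat.
by rewrite !size_cat.
Qed.

Lemma context_lt (a b : seq (I * I)) : ((size a).+2 <= size a + (size b).+2)%N.
Proof. by rewrite !addnS !ltnS leq_addr. Qed.

Lemma bool_scale_inj (b c : bool) (x : C) :
  b != c -> b%:R * x = c%:R * x -> x = 0.
Proof. by case: b; case: c => //= _; rewrite mul1r mul0r. Qed.

(** Cubicity of q: the projection on equal labels is symmetric for psi, so the
words that it treats differently on the two sides are killed. *)
Lemma functional_white a i i' j j' b : (i == i') != (j == j') ->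
  functional (a ++ [:: (i, j); (i', j')] ++ b) = 0.
Proof.
move=> neq; rewrite functional_cat2; set k := (_ + _)%N.
set v1 := ctx _ _; set v2 := ctx _ _.
have e1 : white_proj (size a) v1 = scale (i == i')%:R v1.
  rewrite /v1 -[in LHS](size_unzip1 a) -(size_map delta) white_proj_ctx.
  by rewrite white_proj_delta ctx_scale.
have e2 : white_proj (size a) v2 = scale (j == j')%:R v2.
  rewrite /v2 -[in LHS](size_unzip2 a) -(size_map delta) white_proj_ctx.
  by rewrite white_proj_delta ctx_scale.
have := psi_white v1 v2 (context_lt a b).
by rewrite e1 e2 psi_scalel psi_scaler => /(bool_scale_inj neq) ->; rewrite mulr0.
Qed.

(** Cubicity of p, by the same argument with columns of H' and H in place of
basis vectors. *)
Lemma functional_black a al al' be be' b : (al == al') != (be == be') ->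
  \sum_i \sum_i' \sum_j \sum_j' H' i al * (H' i' al' * (H j be * (H j' be' *
    functional (a ++ [:: (i, j); (i', j')] ++ b)))) = 0.
Proof.
move=> neq; set k := (size a + (size b).+2)%N.
set A1 := [seq delta x | x <- unzip1 a]; set A2 := [seq delta x | x <- unzip2 a].
set B1 := word_state (unzip1 b); set B2 := word_state (unzip2 b).
pose v1 := ctx A1 (vcons (H'^~ al) (vcons (H'^~ al') B1)).
pose v2 := ctx A2 (vcons (H^~ be) (vcons (H^~ be') B2)).
have lA u A : linear_op (ctx A \o vcons u).
  exact: (linear_comp (linear_ctx A) (linear_vcons u)).
transitivity (psi_norm k * psi k v1 v2).
  rewrite (psi_suml k (H'^~ al) _ v2 (linear_ctx A1)) mulr_sumr.
  apply: eq_bigr => i _; rewrite (psi_suml k (H'^~ al') _ v2 (lA _ A1)).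
  rewrite !mulr_sumr; apply: eq_bigr => i' _.
  rewrite (psi_sumr k (H^~ be) _ _ (linear_ctx A2)) !mulr_sumr.
  apply: eq_bigr => j _; rewrite (psi_sumr k (H^~ be') _ _ (lA _ A2)).
  rewrite !mulr_sumr; apply: eq_bigr => j' _.
  by rewrite functional_cat2 -/k [in RHS]mulrCA; congr (_ * _);
    rewrite [in RHS]mulrCA; congr (_ * _); rewrite [in RHS]mulrCA; congr (_ * _);
    rewrite [in RHS]mulrCA.
have e1 : black_proj H' (size a) v1 = scale (al == al')%:R v1.
  rewrite /v1 -[in LHS](size_unzip1 a) -(size_map delta) black_proj_ctx.
  by rewrite black_proj_column // ctx_scale.
have e2 : black_proj H (size a) v2 = scale (be == be')%:R v2.
  rewrite /v2 -[in LHS](size_unzip2 a) -(size_map delta) black_proj_ctx.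
  by rewrite black_proj_column // ctx_scale.
have := psi_black v1 v2 (context_lt a b).
by rewrite e1 e2 psi_scalel psi_scaler => /(bool_scale_inj neq) ->; rewrite mulr0.
Qed.

Lemma psi_cups_sumr k L g' F : linear_op L ->
  psi k g' (L (cup 1 (cup 0 F))) =
  \sum_m psi k g' (L (vcons (delta m) (vcons (delta m) F))).
Proof.
move=> lL; rewrite cupsE.
rewrite (_ : (fun s => _) = fun s => \sum_m 1 * vcons (delta m) (vcons (delta m) F) s);
  last by apply/funext => s; apply: eq_bigr => m _; rewrite mul1r.
rewrite lL /psi linear_sort pairing_sumr.
by apply: eq_bigr => m _; rewrite mul1r.
Qed.

Lemma psi_cups_suml k L g F : linear_op L ->
  psi k (L (cup 1 (cup 0 F))) g =
  \sum_m psi k (L (vcons (delta m) (vcons (delta m) F))) g.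
Proof.
move=> lL; rewrite cupsE.
rewrite (_ : (fun s => _) = fun s => \sum_m 1 * vcons (delta m) (vcons (delta m) F) s);
  last by apply/funext => s; apply: eq_bigr => m _; rewrite mul1r.
rewrite lL /psi linear_sort pairing_suml.
by apply: eq_bigr => m _; rewrite mul1r.
Qed.

(** Both sides are the same pairing with a black projection, moved from one
argument to the other. *)
Lemma functional_row_col a i j b :
  \sum_m functional (a ++ [:: (i, m); (i, m)] ++ b) =
  \sum_m functional (a ++ [:: (m, j); (m, j)] ++ b).
Proof.
under eq_bigr do rewrite functional_cat2.
under [RHS]eq_bigr do rewrite functional_cat2.
rewrite -!mulr_sumr; congr (_ * _).
rewrite -psi_cups_sumr; last exact: linear_ctx.
rewrite -psi_cups_suml; last exact: linear_ctx.
set k := (_ + _)%N; set v1 := ctx _ _; set v2 := ctx _ _.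
set w1 := ctx _ _; set w2 := ctx _ _.
have E1 : black_proj H' (size a) v1 = scale nI^-1 w1.
  rewrite /v1 -[in LHS](size_unzip1 a) -(size_map delta) black_proj_ctx.
  by rewrite black_proj_delta // ctx_scale.
have E2 : black_proj H (size a) w2 = scale nI^-1 v2.
  rewrite /w2 -[in LHS](size_unzip2 a) -(size_map delta) black_proj_ctx.
  by rewrite black_proj_delta // ctx_scale.
have := psi_black v1 w2 (context_lt a b).
rewrite E1 E2 psi_scalel psi_scaler => /mulfI -> //.
by rewrite invr_neq0.
Qed.

(** The sum may be taken for the index of the next letter; cubicity then leaves
only the cube of that letter, which is symmetric. *)
Lemma functional_contract_rcons a i0 j0 i b :
  \sum_m functional (a ++ [:: (i, m); (i, m)] ++ (i0, j0) :: b) =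
  \sum_m functional ((rcons a (i0, j0)) ++ [:: (i, m); (i, m)] ++ b).
Proof.
rewrite (functional_row_col _ _ j0) -(functional_row_col _ i0).
rewrite [RHS](functional_row_col _ _ j0) -[RHS](functional_row_col _ i0).
transitivity (functional (a ++ [:: (i0, j0); (i0, j0); (i0, j0)] ++ b)).
  rewrite (bigD1 j0) //= big1 ?addr0 // => m mj.
  have := @functional_white (rcons a (i0, m)) i0 i0 m j0 b.
  by rewrite cat_rcons eqxx (negPf mj) => ->.
rewrite (bigD1 j0) //= cat_rcons big1 ?addr0 // => m mj.
have := @functional_white a i0 i0 j0 m ((i0, m) :: b).
by rewrite cat_rcons eqxx [j0 == m]eq_sym (negPf mj) => ->.
Qed.

(** The sum does not depend on the free index; averaged over it, it becomes the
pairing of two states with cups at the head. *)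
Lemma functional_contract0 i w :
  \sum_m functional ([:: (i, m); (i, m)] ++ w) = functional w.
Proof.
apply: (mulfI cardI_neq0).
transitivity (\sum_i' \sum_m functional ([:: (i', m); (i', m)] ++ w)).
  rewrite mulr_natl -sumr_const; apply: eq_bigr => i' _.
  by rewrite (functional_row_col [::] _ i) -(functional_row_col [::] i').
have E i' m : functional ([:: (i', m); (i', m)] ++ w) =
    psi_norm (size w).+2 * psi (size w).+2
      (vcons (delta i') (vcons (delta i') (word_state (unzip1 w))))
      (vcons (delta m) (vcons (delta m) (word_state (unzip2 w)))) by [].
under eq_bigr do under eq_bigr do rewrite E.
under eq_bigr do rewrite -mulr_sumr -(@psi_cups_sumr _ id) //.
rewrite -mulr_sumr -(@psi_cups_suml _ id) // psi_cups /=.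
by rewrite -mulrA -[X in _ * X = _]mulrA mulKf ?cup_norm_neq0.
Qed.

Lemma functional_row a i b :
  \sum_m functional (a ++ [:: (i, m); (i, m)] ++ b) = functional (a ++ b).
Proof.
elim/last_ind: a b => [|a [i0 j0] IH] b; first exact: functional_contract0.
by rewrite -functional_contract_rcons IH cat_rcons.
Qed.

Lemma functional_col a j b :
  \sum_m functional (a ++ [:: (m, j); (m, j)] ++ b) = functional (a ++ b).
Proof. by rewrite -(functional_row_col _ j) functional_row. Qed.

End Functional.
End Strands.

(** * The generated *-subalgebra *)

Section GeneratedSubalgebra.
Variables (C : numClosedFieldType) (A : starAlgType C) (X : A -> Prop).

Definition in_star_gen : {pred A} := fun x => `[< star_gen X x >].

Lemma in_star_genP x : reflect (star_gen X x) (x \in in_star_gen).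
Proof. exact: asboolP. Qed.

Fact star_gen_subalg_closed : GRing.subalg_closed in_star_gen.
Proof.
split=> [|a u v /in_star_genP gu /in_star_genP gv|u v /in_star_genP gu /in_star_genP gv].
- by apply/in_star_genP; apply: star_gen_1.
- by apply/in_star_genP; apply: star_gen_lin.
- by apply/in_star_genP; apply: star_gen_mul.
Qed.

HB.instance Definition _ :=
  GRing.isSubalgClosed.Build C A in_star_gen
    (GRing.subalg_closed_semi star_gen_subalg_closed).

Record generated := Generated { gen_val : A; _ : gen_val \in in_star_gen }.
HB.instance Definition _ := [isSub for gen_val].
HB.instance Definition _ := [Choice of generated by <:].
HB.instance Definition _ := [SubChoice_isSubAlgebra of generated by <:].

Lemma star_generated (x : generated) : star (val x) \in in_star_gen.
Proof.
by apply/in_star_genP/star_gen_star/in_star_genP; case: x.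
Qed.

Definition gen_star (x : generated) : generated := Generated (star_generated x).

Fact gen_starK : involutive gen_star.
Proof. by move=> x; apply: val_inj; rewrite /= starK. Qed.
Fact gen_star_semilinear (a : C) (x y : generated) :
  gen_star (a *: x + y) = a^* *: gen_star x + gen_star y.
Proof. by apply: val_inj; rewrite /= star_semilinear. Qed.
Fact gen_starM (x y : generated) : gen_star (x * y) = gen_star y * gen_star x.
Proof. by apply: val_inj; rewrite /= starM. Qed.

HB.instance Definition _ :=
  isStarAlgebra.Build C generated gen_starK gen_star_semilinear gen_starM.

Lemma star_gen_generated (x : generated) :
  star_gen (fun y : generated => X (val y)) x.
Proof.
case: x => x xX; have /in_star_genP gx := xX.
elim: gx xX => {x} [x Xx|| a x y gx IHx gy IHy | x y gx IHx gy IHy | x gx IHx] h.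
- exact: star_gen_in.
- rewrite (_ : Generated h = 1); last exact: val_inj.
  exact: star_gen_1.
- have hx : x \in in_star_gen by apply/in_star_genP.
  have hy : y \in in_star_gen by apply/in_star_genP.
  rewrite (_ : Generated h = a *: Generated hx + Generated hy); last exact: val_inj.
  exact: star_gen_lin.
- have hx : x \in in_star_gen by apply/in_star_genP.
  have hy : y \in in_star_gen by apply/in_star_genP.
  rewrite (_ : Generated h = Generated hx * Generated hy); last exact: val_inj.
  exact: star_gen_mul.
- have hx : x \in in_star_gen by apply/in_star_genP.
  rewrite (_ : Generated h = star (Generated hx)); last exact: val_inj.
  exact: star_gen_star.
Qed.

End GeneratedSubalgebra.

(** * Pairs of operators as a *-algebra *)

(** A complex vector space with a conjugation and a chosen nonzero vector; the
latter makes the algebra of operators nonzero. *)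
Record real_module (C : numClosedFieldType) := RealModule {
  rm_sort :> lmodType C;
  rm_conj : rm_sort -> rm_sort;
  rm_conjK : involutive rm_conj;
  rm_conj_semilinear : forall (a : C) u v,
    rm_conj (a *: u + v) = a^* *: rm_conj u + rm_conj v;
  rm_vec : rm_sort;
  rm_vec_neq0 : rm_vec != 0
}.

Section OperatorPairs.
Variables (C : numClosedFieldType) (M : real_module C).

Notation conj_op := (@rm_conj C M).

Definition lin_endo (T : M -> M) :=
  forall (a : C) u v, T (a *: u + v) = a *: T u + T v.

(** An element of End(M) x End(M)^op: the second operator stands for an adjoint,
so that exchanging the two, up to conjugation, is a star operation. *)
Definition lin_pair : {pred (M -> M) * (M -> M)} :=
  fun p => `[< lin_endo p.1 /\ lin_endo p.2 >].

Fact lin_pair_submod_closed : GRing.submod_closed lin_pair.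
Proof.
split.
  by apply/asboolP; split=> a u v; change (0 = a *: 0 + 0 :> M);
    rewrite scaler0 addr0.
move=> b p q /asboolP[p1 p2] /asboolP[q1 q2]; apply/asboolP.
have E (T S : M -> M) : lin_endo T -> lin_endo S ->
    lin_endo (fun m => b *: T m + S m).
  move=> lT lS a u v; rewrite lT lS !scalerDr addrACA.
  by rewrite !scalerA [a * b]mulrC.
by split; [exact: (E p.1 q.1) | exact: (E p.2 q.2)].
Qed.

HB.instance Definition _ :=
  GRing.isSubmodClosed.Build C ((M -> M) * (M -> M))%type lin_pair
    (GRing.submod_closed_semi lin_pair_submod_closed).

Record op_pair := OpPair { op_val : (M -> M) * (M -> M); _ : op_val \in lin_pair }.
HB.instance Definition _ := [isSub for op_val].
HB.instance Definition _ := [Choice of op_pair by <:].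
HB.instance Definition _ := [SubChoice_isSubLmodule of op_pair by <:].

Lemma op_pair_lin (x : op_pair) : lin_endo (val x).1 /\ lin_endo (val x).2.
Proof. by case: x => p /= /asboolP. Qed.

Lemma lin_endo_comp S T : lin_endo S -> lin_endo T -> lin_endo (S \o T).
Proof. by move=> lS lT a u v; rewrite /= lT lS. Qed.

Fact op_one_subproof : (id, id) \in lin_pair.
Proof. by apply/asboolP. Qed.
Definition op_one := OpPair op_one_subproof.

Fact op_mul_subproof (x y : op_pair) :
  ((val x).1 \o (val y).1, (val y).2 \o (val x).2) \in lin_pair.
Proof.
by apply/asboolP; split; apply: lin_endo_comp;
  case: (op_pair_lin x) (op_pair_lin y) => [? ?] [? ?].
Qed.
Definition op_mul x y := OpPair (op_mul_subproof x y).

Lemma op_pair_eq (x y : op_pair) :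
  (forall m, (val x).1 m = (val y).1 m) ->
  (forall m, (val x).2 m = (val y).2 m) -> x = y.
Proof.
move=> h1 h2; apply: val_inj; rewrite [LHS]surjective_pairing [RHS]surjective_pairing.
by congr pair; apply/funext.
Qed.

Lemma lin_endoD T u v : lin_endo T -> T (u + v) = T u + T v.
Proof. by move=> lT; have := lT 1 u v; rewrite !scale1r. Qed.

Lemma lin_endoZ T a u : lin_endo T -> T (a *: u) = a *: T u.
Proof.
move=> lT; have := lT a u 0; rewrite !addr0 => ->.
by have := lT (-1) 0 0; rewrite scaler0 addr0 scaleN1r addNr => ->; rewrite addr0.
Qed.

Fact op_mulA : associative op_mul.
Proof. by move=> x y t; apply: op_pair_eq. Qed.
Fact op_mul1 : left_id op_one op_mul.
Proof. by move=> x; apply: op_pair_eq. Qed.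
Fact op_mulr1 : right_id op_one op_mul.
Proof. by move=> x; apply: op_pair_eq. Qed.
Fact op_mulDl : left_distributive op_mul +%R.
Proof.
move=> x y t; apply: op_pair_eq => m //=.
by apply: lin_endoD; case: (op_pair_lin t).
Qed.
Fact op_mulDr : right_distributive op_mul +%R.
Proof.
move=> t x y; apply: op_pair_eq => m //=.
by apply: lin_endoD; case: (op_pair_lin t).
Qed.
Fact op_one_neq0 : op_one != 0.
Proof.
apply/eqP => /(congr1 (fun x : op_pair => (val x).1 (rm_vec M))) /= /eqP.
by apply/negP/rm_vec_neq0.
Qed.
HB.instance Definition _ := GRing.Zmodule_isNzRing.Build op_pair
  op_mulA op_mul1 op_mulr1 op_mulDl op_mulDr op_one_neq0.

Fact op_scaleAl (a : C) (x y : op_pair) : a *: (x * y) = a *: x * y.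
Proof.
apply: op_pair_eq => m //=.
by rewrite -[RHS]/((val y).2 (a *: (val x).2 m)) lin_endoZ //; case: (op_pair_lin y).
Qed.
HB.instance Definition _ := GRing.Lmodule_isLalgebra.Build C op_pair op_scaleAl.
Fact op_scaleAr (a : C) (x y : op_pair) : a *: (x * y) = x * (a *: y).
Proof.
apply: op_pair_eq => m //=.
by rewrite -[RHS]/((val x).1 (a *: (val y).1 m)) lin_endoZ //; case: (op_pair_lin x).
Qed.
HB.instance Definition _ := GRing.Lalgebra_isAlgebra.Build C op_pair op_scaleAr.

Lemma lin_endo_conj T : lin_endo T -> lin_endo (conj_op \o T \o conj_op).
Proof.
by move=> lT a u v; rewrite /= rm_conj_semilinear lT rm_conj_semilinear conjCK.
Qed.

Fact op_star_subproof (x : op_pair) :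
  (conj_op \o (val x).2 \o conj_op, conj_op \o (val x).1 \o conj_op) \in lin_pair.
Proof.
by apply/asboolP; case: (op_pair_lin x) => l1 l2; split; exact: lin_endo_conj.
Qed.
Definition op_star x := OpPair (op_star_subproof x).

Fact op_starK : involutive op_star.
Proof.
by move=> x; apply: op_pair_eq => m; rewrite /= !rm_conjK.
Qed.
Fact op_star_semilinear (a : C) (x y : op_pair) :
  op_star (a *: x + y) = a^* *: op_star x + op_star y.
Proof.
apply: op_pair_eq => m; rewrite [RHS]/= [LHS]/=.
  exact: (rm_conj_semilinear a ((val x).2 (conj_op m)) ((val y).2 (conj_op m))).
exact: (rm_conj_semilinear a ((val x).1 (conj_op m)) ((val y).1 (conj_op m))).
Qed.
Fact op_starM (x y : op_pair) : op_star (x * y) = op_star y * op_star x.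
Proof. by apply: op_pair_eq => m; rewrite /= ?rm_conjK. Qed.

HB.instance Definition _ :=
  isStarAlgebra.Build C op_pair op_starK op_star_semilinear op_starM.

End OperatorPairs.

(** * From a functional to a *-algebra *)

Section Presentation.
Variables (C : numClosedFieldType) (L : finType).

Notation relator := (seq (C * seq L)).

(** A relator is a linear combination of words; it is killed with all words
around it, so that the ideal that it generates is killed. *)
Definition kills (f : seq L -> C^o) (r : relator) : Prop :=
  forall a b, \sum_(cw <- r) cw.1 * f (a ++ cw.2 ++ b) = 0.

Definition rev_relator (r : relator) : relator :=
  [seq (cw.1, rev cw.2) | cw <- r].

(** Real coefficients and closure under reversal make the relator compatible
with the involution that fixes the letters. *)
Definition star_relator (f : seq L -> C^o) (r : relator) : Prop :=
  [/\ forall cw, cw \in r -> cw.1^* = cw.1, kills f r & kills f (rev_relator r)].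

Lemma rev_relatorK : involutive rev_relator.
Proof.
by move=> r; rewrite /rev_relator -map_comp map_id_in // => -[c w] _ /=; rewrite revK.
Qed.

Lemma star_relator_rev f r : star_relator f r -> star_relator f (rev_relator r).
Proof.
case=> rC kr krr; split=> //; last by rewrite rev_relatorK.
by move=> _ /mapP[cw /rC cwr ->].
Qed.

Variables (phi : seq L -> C^o) (phi_nil : phi [::] = 1).
Local Notation R := (star_relator phi).

Definition killing : {pred seq L -> C^o} :=
  fun f => `[< forall r, R r -> kills f r >].

Fact killing_submod_closed : GRing.submod_closed killing.
Proof.
split=> [|a f g /asboolP kf /asboolP kg]; apply/asboolP => r Rr u v.
  by rewrite big1 // => cw _; rewrite mulr0.
transitivity (a * (\sum_(cw <- r) cw.1 * f (u ++ cw.2 ++ v)) +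
              \sum_(cw <- r) cw.1 * g (u ++ cw.2 ++ v)); last first.
  by rewrite kf // kg // mulr0 addr0.
rewrite mulr_sumr -big_split; apply: eq_bigr => cw _ /=.
by rewrite mulrCA -mulrDr.
Qed.

HB.instance Definition _ :=
  GRing.isSubmodClosed.Build C (seq L -> C^o) killing
    (GRing.submod_closed_semi killing_submod_closed).

Record functionals := Functional { fun_val : seq L -> C^o; _ : fun_val \in killing }.
HB.instance Definition _ := [isSub for fun_val].
HB.instance Definition _ := [Choice of functionals by <:].
HB.instance Definition _ := [SubChoice_isSubLmodule of functionals by <:].

Lemma functional_kills (f : functionals) r : R r -> kills (val f) r.
Proof. by case: f => f /= /asboolP; apply. Qed.

Lemma functional_eq (f g : functionals) : val f =1 val g -> f = g.
Proof. by move=> fg; apply/val_inj/funext. Qed.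

Fact conj_subproof (f : functionals) : (fun w => (val f w)^*) \in killing.
Proof.
apply/asboolP => r Rr a b; apply: (can_inj (@conjCK C)); rewrite rmorph0.
rewrite -[RHS](functional_kills f Rr a b) rmorph_sum.
rewrite big_seq [RHS]big_seq; apply: eq_bigr => cw cwr.
by case: Rr => /(_ cw cwr) cwR _ _; rewrite rmorphM /= conjCK cwR.
Qed.
Definition conj_functional f := Functional (conj_subproof f).

Fact conj_functionalK : involutive conj_functional.
Proof. by move=> f; apply: functional_eq => w /=; rewrite conjCK. Qed.
Fact conj_functional_semilinear (a : C) (f g : functionals) :
  conj_functional (a *: f + g) = a^* *: conj_functional f + conj_functional g.
Proof.
apply: functional_eq => w; rewrite -[LHS]/((a * val f w + val g w)^*).
by rewrite rmorphD rmorphM.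
Qed.

Fact phi_subproof : phi \in killing.
Proof. by apply/asboolP => r []. Qed.
Definition phi_functional := Functional phi_subproof.
Fact phi_functional_neq0 : phi_functional != 0.
Proof.
apply/eqP => phi0; have /eqP[] := oner_neq0 C; rewrite -phi_nil.
exact: (congr1 (fun f : functionals => val f [::]) phi0).
Qed.

Definition functional_module : real_module C :=
  RealModule conj_functionalK conj_functional_semilinear phi_functional_neq0.

Fact shift_subproof l (f : functionals) : (fun w => val f (rcons w l)) \in killing.
Proof.
apply/asboolP => r Rr a b; have := functional_kills f Rr a (rcons b l).
by under eq_bigr do rewrite -!rcons_cat.
Qed.
(** The letters act on functionals by multiplication on the right of the
argument. *)
Definition shift l (f : functional_module) : functional_module :=
  Functional (shift_subproof l f).

Fact shift_pair_subproof l : (shift l, shift l) \in @lin_pair _ functional_module.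
Proof. by apply/asboolP; split=> a u v; apply: functional_eq. Qed.

Definition letter_op (l : L) : op_pair functional_module :=
  OpPair (shift_pair_subproof l).

Lemma star_letter_op l : star (letter_op l) = letter_op l.
Proof.
by apply: op_pair_eq => f; apply: functional_eq => w /=; rewrite conjCK.
Qed.

Lemma word_op1 (w : seq L) (f : functional_module) b :
  val ((val (\prod_(l <- w) letter_op l)).1 f) b = val f (b ++ w).
Proof.
elim: w b => [|l w IH] b; first by rewrite big_nil cats0.
by rewrite big_cons /= IH cat_rcons.
Qed.

Lemma word_op2 (w : seq L) (f : functional_module) b :
  val ((val (\prod_(l <- w) letter_op l)).2 f) b = val f (b ++ rev w).
Proof.
elim: w f b => [|l w IH] f b; first by rewrite big_nil cats0.
by rewrite big_cons /= IH /= rev_cons rcons_cat.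
Qed.

(** The second components compose in the opposite order, so there the relation is
the one given by the reversed relator. *)
Lemma relator_op r : R r ->
  \sum_(cw <- r) cw.1 *: \prod_(l <- cw.2) letter_op l = 0.
Proof.
move=> Rr.
have E1 (s : relator) f b : val ((val (\sum_(cw <- s) cw.1 *: \prod_(l <- cw.2) letter_op l)).1 f) b
   = \sum_(cw <- s) cw.1 * val f (b ++ cw.2).
  elim: s => [|cw s IH]; first by rewrite !big_nil.
  by rewrite !big_cons -IH /= -word_op1.
have E2 (s : relator) f b : val ((val (\sum_(cw <- s) cw.1 *: \prod_(l <- cw.2) letter_op l)).2 f) b
   = \sum_(cw <- s) cw.1 * val f (b ++ rev cw.2).
  elim: s => [|cw s IH]; first by rewrite !big_nil.
  by rewrite !big_cons -IH /= -word_op2.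
apply: op_pair_eq => f; apply: functional_eq => b.
  rewrite E1 -[RHS](functional_kills f Rr b [::]).
  by apply: eq_bigr => cw _; rewrite cats0.
rewrite E2 -[RHS](functional_kills f (star_relator_rev Rr) b [::]) big_map.
by apply: eq_bigr => cw _; rewrite cats0.
Qed.

End Presentation.

Lemma star_gen_sub (C : numClosedFieldType) (A : starAlgType C) (X Y : A -> Prop) x :
  (forall y, X y -> Y y) -> star_gen X x -> star_gen Y x.
Proof.
move=> XY; elim=> {x} [x /XY||a x y _ gx _ gy|x y _ gx _ gy|x _ gx].
- exact: star_gen_in.
- exact: star_gen_1.
- exact: star_gen_lin.
- exact: star_gen_mul.
- exact: star_gen_star.
Qed.

(** The functional itself is a nonzero element of the module on which the letters
act, so the relations hold in an algebra with nonzero unit. *)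
Theorem star_algebra_of_functional (C : numClosedFieldType) (L : finType)
    (phi : seq L -> C) :
  phi [::] = 1 ->
  exists (A : starAlgType C) (q : L -> A),
    [/\ forall x : A, star_gen (fun y => exists l, y = q l) x,
        forall l, star (q l) = q l
      & forall r, star_relator phi r ->
          \sum_(cw <- r) cw.1 *: \prod_(l <- cw.2) q l = 0].
Proof.
move=> phi1.
pose q0 := @letter_op C L phi phi1.
pose X y := exists l, y = q0 l.
have Xq l : q0 l \in in_star_gen X.
  by apply/in_star_genP/star_gen_in; exists l.
pose q l : generated X := Generated (Xq l).
exists (generated X : starAlgType C), q; split.
- move=> x; apply: star_gen_sub (star_gen_generated x) => y [l yl].
  by exists l; apply: val_inj.
- by move=> l; apply: val_inj; exact: star_letter_op.
- move=> r Rr; apply: val_inj; rewrite rmorph0 -[RHS](relator_op phi1 Rr).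
  rewrite rmorph_sum; apply: eq_bigr => cw _.
  by rewrite -[LHS]/(cw.1 *: val (\prod_(l <- cw.2) q l)) rmorph_prod.
Qed.

(** * Cubic matrices *)

Section CubicMatrices.
Variables (C : numClosedFieldType) (A : starAlgType C).

Lemma scalars_mulmx_tr m n p (S : 'M[C]_(m, n)) (Q : 'M[A]_(n, p)) :
  (scalars_mx A S *m Q)^T = Q^T *m (scalars_mx A S)^T.
Proof.
apply/matrixP => i j; rewrite !mxE; apply: eq_bigr => k _.
by rewrite !mxE /= mulr_algl mulr_algr.
Qed.

Lemma mulmx_scalars_tr m n p (Q : 'M[A]_(m, n)) (S : 'M[C]_(n, p)) :
  (Q *m scalars_mx A S)^T = (scalars_mx A S)^T *m Q^T.
Proof.
apply/matrixP => i j; rewrite !mxE; apply: eq_bigr => k _.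
by rewrite !mxE /= mulr_algl mulr_algr.
Qed.

Lemma scalars_mxM m n p (S : 'M[C]_(m, n)) (T : 'M[C]_(n, p)) :
  scalars_mx A (S *m T) = scalars_mx A S *m scalars_mx A T.
Proof. exact: map_mxM. Qed.

Lemma scalars_mx1 n : scalars_mx A (1%:M : 'M[C]_n) = 1%:M.
Proof. exact: map_mx1. Qed.

Lemma scalars_mx_central m n (Q : 'M[A]_(m, n)) (a : C) :
  Q *m scalars_mx A a%:M = scalars_mx A a%:M *m Q.
Proof.
rewrite /scalars_mx !map_scalar_mx mul_scalar_mx.
apply/matrixP => i j; rewrite !mxE (bigD1 j) //= big1 ?addr0 => [|k /negPf kj].
  by rewrite !mxE eqxx mulr1n mulr_algl mulr_algr.
by rewrite !mxE kj mulr0n mulr0.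
Qed.

Lemma scalars_mx_tr m n (S : 'M[C]_(m, n)) : (scalars_mx A S)^T = scalars_mx A S^T.
Proof. exact: map_trmx. Qed.

Lemma cubicP m n (Q : 'M[A]_(m, n)) :
  (forall i j, star (Q i j) = Q i j) -> Q *m Q^T = 1%:M -> Q^T *m Q = 1%:M ->
  (forall i i' j j', (i == i') != (j == j') -> Q i j * Q i' j' = 0) -> cubic Q.
Proof.
move=> Qs Qr Qc Q0; split=> // i j k jk; apply: Q0; by rewrite eqxx (negPf jk).
Qed.

(** The relations that make both (q_ij) and its transform by H' and H cubic. *)
Definition quad_relators (I : finType) (q : I * I -> A) (H H' : I -> I -> C) :=
  [/\ forall i i' j j', (i == i') != (j == j') -> q (i, j) * q (i', j') = 0,
      forall i, \sum_m q (i, m) * q (i, m) = 1,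
      forall j, \sum_m q (m, j) * q (m, j) = 1
    & forall a a' b b', (a == a') != (b == b') ->
      \sum_i \sum_i' \sum_j \sum_j' (H' i a * (H' i' a' * (H j b * H j' b'))) *:
        (q (i, j) * q (i', j')) = 0].

End CubicMatrices.

(** Each quadratic relation is a linear combination of words of length two, minus
a constant; the reversed combination is again one of these relations. *)
Lemma exists_quad_relators (C : numClosedFieldType) (I : finType)
    (H H' : I -> I -> C) :
  #|I|%:R != 0 :> C -> orthogonal_pm H -> orthogonal_pm H' ->
  (forall i j, (H i j)^* = H i j) -> (forall i j, (H' i j)^* = H' i j) ->
  exists (A : starAlgType C) (q : I * I -> A),
    [/\ forall x : A, star_gen (fun y => exists l, y = q l) x,
        forall l, star (q l) = q l & quad_relators q H H'].
Proof.
move=> nI0 hH hH' rH rH'.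
have [z _|I0] := pickP I; last first.
  by have := eq_card0 I0 => cI; rewrite cI eqxx in nI0.
pose phi := functional z H H'.
have phi1 : phi [::] = 1 by exact: functional_nil.
have [A [q [qgen qs qR]]] := star_algebra_of_functional phi1.
exists A, q; split=> //.
have sum_relator (T : finType) (c : T -> C) (u v : T -> I * I) :
    \sum_(cw <- [seq (c x, [:: u x; v x]) | x : T]) cw.1 *: \prod_(l <- cw.2) q l
    = \sum_x c x *: (q (u x) * q (v x)).
  rewrite big_image /=; apply: eq_bigr => x _.
  by rewrite !big_cons big_nil mulr1.
have kill_relator (T : finType) (c : T -> C) (u v : T -> I * I) a b :
    \sum_(cw <- [seq (c x, [:: u x; v x]) | x : T]) cw.1 * phi (a ++ cw.2 ++ b)
    = \sum_x c x * phi (a ++ [:: u x; v x] ++ b).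
  by rewrite big_image.
(* The relator has the constant term - d, and reversal swaps u and v. *)
have quad_rel (T : finType) (c : T -> C) (u v : T -> I * I) (d : C) :
    (forall x, (c x)^* = c x) -> d^* = d ->
    (forall a b, \sum_x c x * phi (a ++ [:: u x; v x] ++ b) = d * phi (a ++ b)) ->
    (forall a b, \sum_x c x * phi (a ++ [:: v x; u x] ++ b) = d * phi (a ++ b)) ->
    \sum_x c x *: (q (u x) * q (v x)) = d *: 1.
  move=> cC dC k1 k2; apply/eqP; rewrite -subr_eq0 addrC -scaleNr; apply/eqP.
  rewrite -sum_relator.
  have := qR ((- d, [::]) :: [seq (c x, [:: u x; v x]) | x : T]).
  rewrite big_cons big_nil; apply; split.
  - move=> cw; rewrite inE => /predU1P[->|/imageP[x _ ->]] //=.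
    by rewrite rmorphN /= dC.
  - by move=> a b; rewrite big_cons /= kill_relator k1 mulNr addNr.
  - move=> a b; rewrite /rev_relator /= -map_comp big_cons /=.
    by rewrite [X in _ + X]big_image /= k2 mulNr addNr.
have star1 : (1 : C)^* = 1 by exact: rmorph1.
have star0 : (0 : C)^* = 0 by exact: rmorph0.
split.
- move=> i i' j j' neq.
  have := quad_rel unit (fun=> 1) (fun=> (i, j)) (fun=> (i', j')) 0.
  rewrite scale0r big_const card_unit /= scale1r addr0; apply=> // a b;
    rewrite big_const card_unit /= addr0 mul1r mul0r; apply: functional_white => //.
  by rewrite [i' == _]eq_sym [j' == _]eq_sym.
- move=> i; have := quad_rel I (fun=> 1) (fun m => (i, m)) (fun m => (i, m)) 1.
  under eq_bigr do rewrite scale1r.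
  rewrite scale1r; apply=> // a b; rewrite mul1r;
  by under eq_bigr do rewrite mul1r; exact: functional_row.
- move=> j; have := quad_rel I (fun=> 1) (fun m => (m, j)) (fun m => (m, j)) 1.
  under eq_bigr do rewrite scale1r.
  rewrite scale1r; apply=> // a b; rewrite mul1r;
  by under eq_bigr do rewrite mul1r; exact: functional_col.
- move=> a a' b b' neq.
  have := quad_rel (I * I * (I * I))%type
    (fun x => H' x.1.1 a * (H' x.1.2 a' * (H x.2.1 b * H x.2.2 b')))
    (fun x => (x.1.1, x.2.1)) (fun x => (x.1.2, x.2.2)) 0.
  have pair4 (V : nmodType) (F : I -> I -> I -> I -> V) :
      \sum_(x : I * I * (I * I)) F x.1.1 x.1.2 x.2.1 x.2.2 =
      \sum_i \sum_i' \sum_j \sum_j' F i i' j j'.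
    rewrite -(pair_bigA _ (fun y z => F y.1 y.2 z.1 z.2)) /=.
    rewrite -(pair_bigA _ (fun i i' => \sum_(z0 : I * I) F i i' z0.1 z0.2)) /=.
    by apply: eq_bigr => i _; apply: eq_bigr => i' _; rewrite -(pair_bigA _ (F i i')).
  rewrite (pair4 _ (fun i i' j j' => (H' i a * (H' i' a' * (H j b * H j' b'))) *:
        (q (i, j) * q (i', j')))) scale0r; apply=> // [x|a0 b0|a0 b0].
  + by rewrite !rmorphM /= !rH !rH'.
  + rewrite (pair4 _ (fun i i' j j' => (H' i a * (H' i' a' * (H j b * H j' b'))) *
        phi (a0 ++ [:: (i, j); (i', j')] ++ b0))) mul0r.
    rewrite -[RHS](functional_black nI0 z hH hH' a0 b0 neq).
    do 4!(apply: eq_bigr => ? _); by rewrite !mulrA.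
  + rewrite (pair4 _ (fun i i' j j' => (H' i a * (H' i' a' * (H j b * H j' b'))) *
        phi (a0 ++ [:: (i', j'); (i, j)] ++ b0))) mul0r.
    have neq' : (a' == a) != (b' == b) by rewrite [a' == _]eq_sym [b' == _]eq_sym.
    rewrite -[RHS](functional_black nI0 z hH hH' a0 b0 neq').
    rewrite exchange_big; apply: eq_bigr => ? _; apply: eq_bigr => ? _.
    rewrite exchange_big; apply: eq_bigr => ? _; apply: eq_bigr => ? _.
    by rewrite -!mulrA mulrCA [X in _ * (_ * X)]mulrCA.
Qed.

Section StarLinearity.
Variables (C : numClosedFieldType) (A : starAlgType C).

Lemma starD (x y : A) : star (x + y) = star x + star y.
Proof.
by have := star_semilinear (1 : C) x y; rewrite !scale1r rmorph1 scale1r.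
Qed.

Lemma star0 : star (0 : A) = 0.
Proof.
have := star_semilinear (-1 : C) (0 : A) 0.
by rewrite scaler0 addr0 rmorphN rmorph1 scaleN1r addNr.
Qed.

Lemma starZ (a : C) (x : A) : star (a *: x) = a^* *: star x.
Proof. by have := star_semilinear a x 0; rewrite !addr0 star0 addr0. Qed.

Lemma star_sum (I : finType) (F : I -> A) :
  star (\sum_i F i) = \sum_i star (F i).
Proof. exact: (big_morph _ starD star0). Qed.

End StarLinearity.

Lemma card_ord_neq0 (C : numClosedFieldType) n : #|'I_n.+1|%:R != 0 :> C.
Proof. by rewrite card_ord pnatr_eq0. Qed.

Section HadamardMatrices.
Variable C : numClosedFieldType.

Lemma hadamard_conj N (H : 'M[C]_N) i j : hadamard_mx H -> (H i j)^* = H i j.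
Proof. by case=> Hpm _ _; case: (Hpm i j) => ->; rewrite ?rmorphN rmorph1. Qed.

(** The transpose appears because q acts on the column indices of H. *)
Lemma hadamard_orthogonal_pm N (H : 'M[C]_N) :
  hadamard_mx H -> orthogonal_pm (fun i b => H b i).
Proof.
case=> Hpm Hr Hc; split=> [a b|a b|a b].
- by case: (Hpm b a) => ->; rewrite ?mulrNN mulr1.
- have /matrixP/(_ a b) := Hc; rewrite !mxE card_ord => <-.
  by apply: eq_bigr => c _; rewrite mxE.
- have /matrixP/(_ a b) := Hr; rewrite !mxE card_ord => <-.
  by apply: eq_bigr => c _; rewrite mxE.
Qed.

Lemma hadamard_right_inverse N (H : 'M[C]_N.+1) :
  hadamard_mx H -> H *m (N.+1%:R^-1 *: H^T) = 1%:M.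
Proof.
by case=> _ Hr _; rewrite -scalemxAr Hr scale_scalar_mx mulVf // pnatr_eq0.
Qed.

Lemma hadamard_unit N (H : 'M[C]_N) : hadamard_mx H -> H \in unitmx.
Proof.
case: N H => [|N] H hH; first by rewrite unitmxE det_mx00 unitr1.
exact: (mulmx1_unit (hadamard_right_inverse hH)).1.
Qed.

Lemma hadamard_invmx N (H : 'M[C]_N.+1) :
  hadamard_mx H -> invmx H = N.+1%:R^-1 *: H^T.
Proof.
move=> hH; rewrite -[RHS]mul1mx -(mulVmx (hadamard_unit hH)) -mulmxA.
by rewrite hadamard_right_inverse // mulmx1.
Qed.

(** Orthogonality of p is inherited from that of q, while its remaining relations
are an assumption on q. *)
Lemma hadamard_cubic (A : starAlgType C) N (H H' : 'M[C]_N.+1)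
    (Q : 'M[A]_N.+1) :
  hadamard_mx H -> hadamard_mx H' ->
  orthogonal_mx Q ->
  (forall a a' b b', (a == a') != (b == b') ->
      \sum_i \sum_i' \sum_j \sum_j' (H' a i * (H' a' i' * (H b j * H b' j'))) *:
        (Q i j * Q i' j') = 0) ->
  cubic (scalars_mx A H' *m Q *m scalars_mx A (invmx H)).
Proof.
move=> hH hH' [Qs Qr Qc] Q0; rewrite (hadamard_invmx hH).
have n0 : N.+1%:R != 0 :> C by rewrite pnatr_eq0.
have [[_ Hr Hc] [_ Hr' Hc']] := (hH, hH').
set S := scalars_mx A H'; set T := scalars_mx A _.
have PE a b : (S *m Q *m T) a b =
    N.+1%:R^-1 *: \sum_i \sum_j (H' a i * H b j) *: Q i j.
  rewrite mxE scaler_sumr; under [RHS]eq_bigr do rewrite scaler_sumr.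
  rewrite [RHS]exchange_big /=; apply: eq_bigr => j _; rewrite !mxE mulr_suml.
  apply: eq_bigr => i _; rewrite !mxE /= mulr_algr mulr_algl !scalerA.
  by congr (_ *: _); rewrite -mulrA [H b j * _]mulrC.
have central (X Y : 'M[A]_N.+1) (a : C) :
    X *m (scalars_mx A a%:M *m Y) = scalars_mx A a%:M *m (X *m Y).
  by rewrite mulmxA scalars_mx_central mulmxA.
have cancel : scalars_mx A N.+1%:R^-1%:M *m scalars_mx A N.+1%:R%:M
    = 1%:M :> 'M[A]_N.+1.
  by rewrite -scalars_mxM -scalar_mxM mulVf // scalars_mx1.
have TTt : T *m T^T = scalars_mx A N.+1%:R^-1%:M.
  rewrite scalars_mx_tr -scalars_mxM [(_ *: _)^T]linearZ /= trmxK -scalemxAl -scalemxAr Hc.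
  by rewrite !scale_scalar_mx mulVf // mulr1.
have TtT : T^T *m T = scalars_mx A N.+1%:R^-1%:M.
  rewrite scalars_mx_tr -scalars_mxM [(_ *: _)^T]linearZ /= trmxK -scalemxAl -scalemxAr Hr.
  by rewrite !scale_scalar_mx mulVf // mulr1.
have SSt : S *m S^T = scalars_mx A N.+1%:R%:M.
  by rewrite scalars_mx_tr -scalars_mxM Hr'.
have StS : S^T *m S = scalars_mx A N.+1%:R%:M.
  by rewrite scalars_mx_tr -scalars_mxM Hc'.
have PtE : (S *m Q *m T)^T = T^T *m (Q^T *m S^T).
  by rewrite mulmx_scalars_tr scalars_mulmx_tr.
apply: cubicP.
- move=> a b; rewrite PE starZ fmorphV rmorph_nat star_sum; congr (_ *: _).
  apply: eq_bigr => i _; rewrite star_sum; apply: eq_bigr => j _.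
  by rewrite starZ rmorphM /= !hadamard_conj // Qs.
- rewrite PtE -!mulmxA [T *m _]mulmxA TTt !central.
  by rewrite [Q *m _]mulmxA Qr mul1mx SSt cancel.
- rewrite PtE -!mulmxA [S^T *m _]mulmxA StS !central [Q^T *m _]mulmxA Qc mul1mx.
  by rewrite TtT -scalars_mx_central cancel.
- move=> a a' b b' neq; rewrite !PE -scalerAl -scalerAr.
  rewrite -[RHS](scaler0 _ N.+1%:R^-1); congr (_ *: _).
  rewrite -[RHS](scaler0 _ N.+1%:R^-1); congr (_ *: _).
  rewrite -[RHS](Q0 _ _ _ _ neq) mulr_suml; apply: eq_bigr => i _.
  rewrite mulr_sumr; apply: eq_bigr => i' _.
  rewrite mulr_suml; apply: eq_bigr => j _.
  rewrite mulr_sumr; apply: eq_bigr => j' _.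
  by rewrite -scalerAl -scalerAr scalerA -!mulrA [H b j * (_ * _)]mulrCA.
Qed.

End HadamardMatrices.

(** * Quantum isomorphisms and magic unitaries *)

Section QuantumIsomorphism.
Variable C : numClosedFieldType.

(** For N = 0 the relations are empty and the constant functional serves. *)
Lemma hadamard_quantum_isomorphic N (H H' : 'M[C]_N) :
  hadamard_mx H -> hadamard_mx H' -> hadamard_qiso H H'.
Proof.
case: N H H' => [|N] H H' hH hH'.
  have [A [q [qgen _ _]]] :=
    star_algebra_of_functional (erefl : (fun _ : seq ('I_0 * 'I_0) => 1 : C) [::] = 1).
  exists A, (\matrix_(i, j) q (i, j)); split.
  - by move=> x; apply: star_gen_sub (qgen x) => y [[[]]].
  - by apply: cubicP; try apply/matrixP; case.
  - by apply: cubicP; try apply/matrixP; case.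
have [] := exists_quad_relators (card_ord_neq0 C N)
  (hadamard_orthogonal_pm hH) (hadamard_orthogonal_pm hH').
- by move=> i j; rewrite hadamard_conj.
- by move=> i j; rewrite hadamard_conj.
move=> A [q [qgen qs [q0 qr qc qb]]].
have cQ : cubic (\matrix_(i, j) q (i, j) : 'M[A]_N.+1).
  apply: cubicP.
  - by move=> i j; rewrite mxE qs.
  - apply/matrixP => i i'; rewrite !mxE; have [<-|ii] := eqVneq i i'.
      by rewrite -[RHS](qr i); apply: eq_bigr => j _; rewrite !mxE.
    by rewrite big1 // => j _; rewrite !mxE q0 // (negPf ii) eqxx.
  - apply/matrixP => j j'; rewrite !mxE; have [<-|jj] := eqVneq j j'.
      by rewrite -[RHS](qc j); apply: eq_bigr => i _; rewrite !mxE.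
    by rewrite big1 // => i _; rewrite !mxE q0 // (negPf jj) eqxx.
  - by move=> i i' j j' neq; rewrite !mxE q0.
exists A, (\matrix_(i, j) q (i, j)); split=> //.
  move=> x; apply: star_gen_sub (qgen x) => y [[i j] ->].
  by exists i, j; rewrite mxE.
apply: hadamard_cubic => // [|a a' b b' neq]; first by case: cQ.
rewrite -[RHS](qb a a' b b' neq).
by do 4!(apply: eq_bigr => ? _); rewrite !mxE.
Qed.

Variable A : starAlgType C.

(** Multiply the row relation sum_k q_ik q_ik = 1 by q_ij. *)
Lemma cubic_sqr_mul m n (Q : 'M[A]_(m, n)) i j :
  cubic Q -> Q i j * Q i j * Q i j = Q i j.
Proof.
case=> [[_ Qr _] Q0 _].
have /matrixP/(_ i i) := Qr; rewrite !mxE eqxx => /(congr1 ( *%R^~ (Q i j))).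
rewrite mul1r mulr_suml (bigD1 j) //= big1 ?addr0 ?mxE // => k kj.
by rewrite mxE -mulrA Q0 // mulr0.
Qed.

Definition sqr_mx m n (Q : 'M[A]_(m, n)) : 'M[A]_(m, n) :=
  \matrix_(i, j) (Q i j * Q i j).
Local Notation half := ((2%:R^-1 : C)%:A : A).
Definition pos_mx m n (Q : 'M[A]_(m, n)) := half *: (sqr_mx Q + Q).
Definition neg_mx m n (Q : 'M[A]_(m, n)) := half *: (sqr_mx Q - Q).
(** The rows and columns of Q doubled by a sign. *)
Definition signed_mx m n (Q : 'M[A]_(m, n)) :=
  block_mx (pos_mx Q) (neg_mx Q) (neg_mx Q) (pos_mx Q).

(** Matrices over A carry a left A-action; this scalar moves across products
since it is central. *)
Lemma half_central m n p (X : 'M[A]_(m, n)) (Y : 'M[A]_(n, p)) :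
  X *m (half *: Y) = half *: (X *m Y).
Proof.
apply/matrixP => i j; rewrite !mxE mulr_sumr; apply: eq_bigr => k _.
by rewrite mxE mulr_algl mulr_algl -scalerAr.
Qed.

Lemma half_add (x : A) : half * (x + x) = x.
Proof.
rewrite mulr_algl -mulr2n -scaler_nat scalerA mulVf ?scale1r //.
by rewrite pnatr_eq0.
Qed.

Lemma half_add_mx m n (X : 'M[A]_(m, n)) : half *: (X + X) = X.
Proof. by apply/matrixP => i j; rewrite !mxE half_add. Qed.

Lemma tr_sqr_mx m n (Q : 'M[A]_(m, n)) : (sqr_mx Q)^T = sqr_mx Q^T.
Proof. by apply/matrixP => i j; rewrite !mxE. Qed.

Lemma cubic_tr m n (Q : 'M[A]_(m, n)) : cubic Q -> cubic Q^T.
Proof.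
case=> [[Qs Qr Qc] Q0 Q0']; split; first split; rewrite ?trmxK //.
- by move=> i j; rewrite mxE.
- by move=> i j k jk; rewrite !mxE Q0'.
- by move=> i j k jk; rewrite !mxE Q0.
Qed.

Lemma cubic_row_sum m n (Q : 'M[A]_(m, n)) i :
  cubic Q -> \sum_j sqr_mx Q i j = 1.
Proof.
case=> [[_ Qr _] _ _]; transitivity ((Q *m Q^T) i i).
  by rewrite mxE; apply: eq_bigr => j _; rewrite !mxE.
by rewrite Qr mxE eqxx.
Qed.

Lemma cubic_sqr_orthogonal m n (Q : 'M[A]_(m, n)) :
  cubic Q -> sqr_mx Q *m (sqr_mx Q)^T = 1%:M.
Proof.
move=> cQ; apply/matrixP => i k; rewrite mxE [RHS]mxE.
have [<-|ik] := eqVneq i k.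
  rewrite -[RHS](cubic_row_sum i cQ); apply: eq_bigr => j _.
  by rewrite !mxE mulrA cubic_sqr_mul.
rewrite big1 // => j _; rewrite !mxE; case: cQ => _ _ Q0.
by rewrite -mulrA [Q i j * (Q k j * _)]mulrA Q0 // mul0r mulr0.
Qed.

Lemma star_signed_mx m n (Q : 'M[A]_(m, n)) i j :
  cubic Q -> star (signed_mx Q i j) = signed_mx Q i j.
Proof.
case=> [[Qs _ _] _ _].
have sP k l : star (pos_mx Q k l) = pos_mx Q k l.
  by rewrite !mxE mulr_algl starZ fmorphV rmorph_nat starD starM !Qs.
have sN k l : star (neg_mx Q k l) = neg_mx Q k l.
  rewrite !mxE mulr_algl starZ fmorphV rmorph_nat starD starM.
  by rewrite -scaleN1r starZ rmorphN rmorph1 !Qs.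
by case: (split_ordP i) => k ->; case: (split_ordP j) => l ->;
  rewrite /signed_mx ?(block_mxEul, block_mxEur, block_mxEdl, block_mxEdr).
Qed.

(** If x^3 = x then x^2 is an idempotent acting as a unit on x. *)
Lemma idem_half (x : A) : x * x * x = x ->
  half * (x * x + x) * (half * (x * x + x)) = half * (x * x + x).
Proof.
move=> x3; have xx : (x * x + x) * (x * x + x) = (x * x + x) + (x * x + x).
  rewrite mulrDl !mulrDr [x * x * (x * x)]mulrA x3 [x * (x * x)]mulrA x3.
  by rewrite [x + x * x]addrC.
by rewrite !mulr_algl -scalerAl -scalerAr xx; congr (_ *: _);
  rewrite -mulr_algl half_add.
Qed.

Lemma idem_signed_mx m n (Q : 'M[A]_(m, n)) i j :
  cubic Q -> signed_mx Q i j * signed_mx Q i j = signed_mx Q i j.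
Proof.
move=> cQ.
have iP k l : pos_mx Q k l * pos_mx Q k l = pos_mx Q k l.
  by rewrite !mxE idem_half // cubic_sqr_mul.
have iN k l : neg_mx Q k l * neg_mx Q k l = neg_mx Q k l.
  rewrite !mxE -[Q k l * Q k l]mulrNN idem_half //.
  by rewrite mulrNN mulrN cubic_sqr_mul.
by case: (split_ordP i) => k ->; case: (split_ordP j) => l ->;
  rewrite /signed_mx ?(block_mxEul, block_mxEur, block_mxEdl, block_mxEdr).
Qed.

Lemma tr_signed_mx m n (Q : 'M[A]_(m, n)) : (signed_mx Q)^T = signed_mx Q^T.
Proof.
by rewrite /signed_mx tr_block_mx /pos_mx /neg_mx !linearZ /= !linearD /=
  linearN /= tr_sqr_mx.
Qed.

(** The sum and the difference of the two blocks are the orthogonal matrices Q^2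
(entrywise) and Q. *)
Lemma signed_mx_row_orthogonal m n (Q : 'M[A]_(m, n)) :
  cubic Q -> signed_mx Q *m (signed_mx Q)^T = 1%:M.
Proof.
move=> cQ; rewrite tr_signed_mx /signed_mx mulmx_block /pos_mx /neg_mx.
rewrite -!scalemxAl !half_central !mulmxDl !mulmxDr !mulmxN !mulNmx opprK.
have [[_ Qr _] _ _] := cQ; rewrite -tr_sqr_mx cubic_sqr_orthogonal // Qr tr_sqr_mx.
rewrite -!scalerDr; set a := sqr_mx Q *m Q^T; set b := Q *m sqr_mx Q^T.
have diag (x y z : 'M[A]_m) :
    x + y + (z + x) + (x - y + (- z + x)) = x + x + (x + x).
  by rewrite addrACA [x + y + _]addrACA [z + x + _]addrACA !subrr add0r addr0.
have offdiag (x y z : 'M[A]_m) : x - y + (z - x) + (x + y + (- z - x)) = 0.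
  rewrite addrACA [x - y + _]addrACA [z - x + _]addrACA addNr subrr add0r addr0.
  by rewrite -opprD subrr.
rewrite offdiag diag [_ + (1%:M - a + (b - 1%:M))]addrC offdiag.
rewrite [_ + (1%:M + a + (b + 1%:M))]addrC diag.
by rewrite !half_add_mx !scaler0 -scalar_mx_block.
Qed.

Lemma signed_mx_row_sum m n (Q : 'M[A]_(m, n)) i :
  cubic Q -> \sum_j signed_mx Q i j = 1.
Proof.
move=> cQ; rewrite big_split_ord /=.
have E k : \sum_(l < n) (pos_mx Q k l + neg_mx Q k l) = 1.
  rewrite -[RHS](cubic_row_sum k cQ); apply: eq_bigr => l _.
  by rewrite !mxE -mulrDr addrACA subrr addr0 half_add.
case: (split_ordP i) => k ->; rewrite -[RHS](E k) big_split /=.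
  by congr (_ + _); apply: eq_bigr => l _; rewrite ?block_mxEul ?block_mxEur.
by rewrite [LHS]addrC; congr (_ + _); apply: eq_bigr => l _;
  rewrite /signed_mx ?block_mxEdl ?block_mxEdr.
Qed.

Lemma signed_mx_magic m n (Q : 'M[A]_(m, n)) : cubic Q -> magic_unitary (signed_mx Q).
Proof.
move=> cQ; have sE : map_mx star (signed_mx Q) = signed_mx Q.
  by apply/matrixP => i j; rewrite mxE star_signed_mx.
split.
- rewrite /unitary_mx sE; split; first exact: signed_mx_row_orthogonal.
  rewrite -[X in _ *m X]trmxK [X in X *m _]tr_signed_mx tr_signed_mx.
  exact/signed_mx_row_orthogonal/cubic_tr.
- by move=> i j; rewrite idem_signed_mx ?star_signed_mx.
- by move=> i; exact: signed_mx_row_sum.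
move=> j; rewrite -[RHS](signed_mx_row_sum j (cubic_tr cQ)) -tr_signed_mx.
by apply: eq_bigr => i _; rewrite [RHS]mxE.
Qed.

Lemma map_mx_star0 m n : map_mx star (0 : 'M[A]_(m, n)) = 0.
Proof. by apply/matrixP => i j; rewrite !mxE star0. Qed.

Lemma magic_unitary_block m n m' n' (U : 'M[A]_(m, n)) (V : 'M[A]_(m', n')) :
  magic_unitary U -> magic_unitary V -> magic_unitary (block_mx U 0 0 V).
Proof.
move=> [[U1 U2] Ui Ur Uc] [[V1 V2] Vi Vr Vc].
split.
- rewrite /unitary_mx map_block_mx tr_block_mx !mulmx_block.
  rewrite !(map_mx_star0, trmx0, mulmx0, mul0mx, addr0, add0r).
  by rewrite U1 U2 V1 V2 !scalar_mx_block.
- move=> i j; case: (split_ordP i) => k ->; case: (split_ordP j) => l ->;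
    rewrite ?(block_mxEul, block_mxEur, block_mxEdl, block_mxEdr) //;
    by rewrite mxE mulr0 star0.
- move=> i; rewrite big_split_ord /=.
  case: (split_ordP i) => k ->.
    rewrite -[RHS](Ur k) [X in _ + X]big1 ?addr0 => [|l _].
      by apply: eq_bigr => l _; rewrite block_mxEul.
    by rewrite block_mxEur mxE.
  rewrite -[RHS](Vr k) [X in X + _]big1 ?add0r => [|l _].
    by apply: eq_bigr => l _; rewrite block_mxEdr.
  by rewrite block_mxEdl mxE.
- move=> i; rewrite big_split_ord /=.
  case: (split_ordP i) => k ->.
    rewrite -[RHS](Uc k) [X in _ + X]big1 ?addr0 => [|l _].
      by apply: eq_bigr => l _; rewrite block_mxEul.
    by rewrite block_mxEdl mxE.
  rewrite -[RHS](Vc k) [X in X + _]big1 ?add0r => [|l _].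
    by apply: eq_bigr => l _; rewrite block_mxEdr.
  by rewrite block_mxEur mxE.
Qed.

End QuantumIsomorphism.

(** * Hadamard graphs *)

Section GraphIsomorphism.
Variable C : numClosedFieldType.

Lemma sqr_mx_const1 (A : starAlgType C) m n p (Q : 'M[A]_(m, n)) :
  cubic Q -> sqr_mx Q *m (const_mx 1 : 'M_(n, p)) = const_mx 1.
Proof.
move=> cQ; apply/matrixP => i j; rewrite !mxE -[RHS](cubic_row_sum i cQ).
by apply: eq_bigr => k _; rewrite !mxE mulr1.
Qed.

Lemma const1_sqr_mx (A : starAlgType C) m n p (Q : 'M[A]_(m, n)) :
  cubic Q -> (const_mx 1 : 'M_(p, m)) *m sqr_mx Q = const_mx 1.
Proof.
move=> cQ; apply/matrixP => i j; rewrite !mxE.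
rewrite -[RHS](cubic_row_sum j (cubic_tr cQ)).
by apply: eq_bigr => k _; rewrite !mxE mul1r.
Qed.

Definition hadamard_block (A : starAlgType C) N (H : 'M[C]_N) : 'M[A]_(N + N) :=
  scalars_mx A (block_mx (hplus H) (hminus H) (hminus H) (hplus H)).

(** On sums of the two blocks both products are the all-ones matrix, by the row
and column sums of squares; on differences the claim is P H = H' Q. *)
Lemma signed_mx_intertwine (A : starAlgType C) N (H H' : 'M[C]_N) (P Q : 'M[A]_N) :
  cubic P -> cubic Q -> P *m scalars_mx A H = scalars_mx A H' *m Q ->
  signed_mx P *m hadamard_block A H = hadamard_block A H' *m signed_mx Q.
Proof.
move=> cP cQ PQ; rewrite /hadamard_block /scalars_mx !map_block_mx -!/(scalars_mx A _).
have hp (K : 'M[C]_N) : scalars_mx A (hplus K) =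
    (2%:R^-1 : C)%:A *: (const_mx 1 + scalars_mx A K).
  apply/matrixP => i j; rewrite !mxE /= mulr_algl -scalerA scalerDl scale1r //.
have hm (K : 'M[C]_N) : scalars_mx A (hminus K) =
    (2%:R^-1 : C)%:A *: (const_mx 1 - scalars_mx A K).
  by apply/matrixP => i j; rewrite !mxE /= mulr_algl -scalerA scalerBl scale1r.
rewrite !hm !hp /signed_mx !mulmx_block /pos_mx /neg_mx.
rewrite -!scalemxAl !half_central -!scalerDr !mulmxDl !mulmxDr !mulmxN !mulNmx opprK.
rewrite !sqr_mx_const1 // !const1_sqr_mx // PQ.
set a := sqr_mx P *m _; set b := P *m _; set c := const_mx 1 *m Q.
set d := scalars_mx A H' *m sqr_mx Q; set e := scalars_mx A H' *m Q.
have same (x y z w : 'M[A]_N) : x + y + (z + w) + (x - y + (- z + w)) = x + w + (x + w).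
  by rewrite addrACA [x + y + _]addrACA [z + w + _]addrACA !subrr add0r addr0 addrACA.
have diff (x y z w : 'M[A]_N) : x - y + (z - w) + (x + y + (- z - w)) = x - w + (x - w).
  by rewrite addrACA [x - y + _]addrACA [z - w + _]addrACA addNr subrr
    add0r addr0 addrACA.
rewrite [- - e]opprK !same !diff.
have same' (x y z w : 'M[A]_N) : x - y + (- z + w) + (x + y + (z + w)) = x + w + (x + w).
  by rewrite addrC same.
have diff' (x y z w : 'M[A]_N) : x + y + (- z - w) + (x - y + (z - w)) = x - w + (x - w).
  by rewrite addrC diff.
by rewrite !same' !diff'.
Qed.

Lemma hadamard_graph_quantum_isomorphic N (H H' : 'M[C]_N)
    (G G' : sgraph ((N + N) + (N + N))) :
  hadamard_mx H -> hadamard_mx H' ->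
  hadamard_graph_of H G -> hadamard_graph_of H' G' -> graph_qiso C G G'.
Proof.
move=> hH hH' hG hG'.
have [A [Q [_ cQ cP]]] := hadamard_quantum_isomorphic hH hH'.
set P := _ *m _ *m _ in cP.
exists A, (block_mx (signed_mx P) 0 0 (signed_mx Q)); split.
  by apply: magic_unitary_block; exact: signed_mx_magic.
have PH : P *m scalars_mx A H = scalars_mx A H' *m Q.
  by rewrite /P -mulmxA -scalars_mxM mulVmx ?hadamard_unit // scalars_mx1 mulmx1.
have QH : Q *m scalars_mx A H^T = scalars_mx A H'^T *m P.
  have [[_ _ Hc] [_ _ Hc']] := (hH, hH').
  rewrite /P !mulmxA -scalars_mxM Hc' -scalars_mx_central -mulmxA -scalars_mxM.
  by rewrite -Hc mulmxK ?hadamard_unit.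
rewrite hG hG' /hadamard_adjmx /scalars_mx [in LHS]map_block_mx [in RHS]map_block_mx.
rewrite -!/(scalars_mx A _) -!/(hadamard_block A _).
have tE (K : 'M[C]_N) :
    scalars_mx A (block_mx (hplus K)^T (hminus K)^T (hminus K)^T (hplus K)^T) =
    hadamard_block A K^T.
  rewrite /hadamard_block; congr scalars_mx.
  by congr block_mx; apply/matrixP => i j; rewrite !mxE.
have z0 : scalars_mx A (0 : 'M[C]_(N + N)) = 0 by exact: map_mx0.
rewrite !tE !z0 !mulmx_block !(mul0mx, mulmx0, addr0, add0r).
by rewrite (signed_mx_intertwine cP cQ PH) (signed_mx_intertwine cQ cP QH).
Qed.
End GraphIsomorphism.

Theorem mainTheorem2 (R : realType) :
  (forall (N : nat) (H H' : 'M[R[i]]_N),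
      hadamard_mx H -> hadamard_mx H' -> hadamard_qiso H H') /\
  (forall (N : nat) (H H' : 'M[R[i]]_N) (G G' : sgraph ((N + N) + (N + N))),
      hadamard_mx H -> hadamard_mx H' ->
      hadamard_graph_of H G -> hadamard_graph_of H' G' ->
      graph_qiso R[i] G G').
Proof.
split=> [N H H'|N H H' G G'].
  exact: hadamard_quantum_isomorphic.
exact: hadamard_graph_quantum_isomorphic.
Qed.
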